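(* There is an absolute constant $c>0$ such that the following holds. For every integer $m \geq 3$ there is $\varepsilon=\varepsilon(m)>0$ such that, for all large enough $n$, every $n$-vertex $3$-graph $G$ with no homogeneous set of size at least $n^{\varepsilon}$ satisfies $s(G;m) \geq c m^3$.
   Context: A $3$-graph is a $3$-uniform hypergraph. A homogeneous set is a vertex set that is either a clique (all its triples are edges) or an independent set (none of its triples is an edge). An $(m,f)$-subset of $G$ is a set of $m$ vertices of $G$ inducing exactly $f$ edges. For a $3$-graph $G$ and $m \geq 3$, $s(G;m)$ denotes the number of integers $0 \leq f \leq \binom{m}{3}$ such that $G$ contains an $(m,f)$-subset. ''Large enough $n$'' may depend on $m$. *)

(* Defs.v *)
From HB Require Import structures.
From mathcomp Require Import all_boot all_order all_algebra.
From mathcomp Require Import reals exp.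

Set Implicit Arguments.
Unset Strict Implicit.
Unset Printing Implicit Defensive.

Record three_graph (V : finType) := ThreeGraph {
  edges : {set {set V}};
  edges_card3 : forall e : {set V}, e \in edges -> #|e| = 3
}.

Section ThreeGraphs.
Variables (V : finType) (G : three_graph V).

Definition is_clique (S : {set V}) : Prop :=
  forall T : {set V}, T \subset S -> #|T| = 3 -> T \in edges G.

Definition is_independent (S : {set V}) : Prop :=
  forall T : {set V}, T \subset S -> #|T| = 3 -> T \notin edges G.

Definition homogeneous (S : {set V}) : Prop :=
  is_clique S \/ is_independent S.

Definition induced_edges (S : {set V}) : {set {set V}} :=
  [set e in edges G | e \subset S].

Definition mf_subset (m f : nat) (S : {set V}) : bool :=
  (#|S| == m) && (#|induced_edges S| == f).

Definition num_induced_sizes (m : nat) : nat :=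
  #|[set f : 'I_('C(m, 3)).+1 | [exists S : {set V}, mf_subset m f S]]|.

End ThreeGraphs.

(* Main.v *)
Require Import Defs.
From mathcomp Require Import all_boot all_order all_algebra.
From mathcomp Require Import reals exp.
From mathcomp Require Import zify ring boolp.
Set Implicit Arguments.
Unset Strict Implicit.
Unset Printing Implicit Defensive.
Import Order.TTheory GRing.Theory Num.Theory.

(** Write [n] for the number of vertices and call a set large if its size is at
    least a fixed, arbitrarily small power of [n]; [m] is a constant, so a bounded
    number of passages to a large subset is allowed. A link, that is the graph of
    the pairs forming an edge with a given vertex, is homogeneous on a set if it
    is complete or empty there. The proof finds, in every 3-graph without large
    homogeneous sets, one of three structures; in each of them the [m]-subsets
    have [(m / 50) ^ 3] different numbers of edges.

    Words. Suppose that every large set contains a vertex whose link is complete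
    on a large subset, and one whose link is empty on a large subset. Choosing
    vertices one after the other gives, for every 0/1-word [a 1 ... a m], vertices
    [v 1, ..., v m] such that the colour of a triple is the letter of its first
    vertex. More generally ([words_rich]), let the vertices of a sequence carry
    labels 0 or 1, let the colour of a triple be a function [g] of the labels of
    its first two vertices, and let all words of labels occur. If [g] is not
    constant, exchanging two adjacent labels changes the number of edges by an
    affine function of the place of the exchange, and suitable exchanges produce
    a cubic number of values.

    Sparse links. Otherwise, up to complementation, there is a large set in which
    no link is complete on a large subset. Suppose that, inside some large subset,
    all links are empty on a large subset of every large set. By a counting
    argument ([supersaturation]) a configuration present in every large set
    occurs with a large set of candidates for any one of its vertices; shrinking
    that set, it becomes independent in the links of the other vertices, and any
    other configuration can be substituted there ([unav_comp]), without creating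
    edges besides the forced ones. Starting from single edges one builds sets
    whose numbers of edges are written with three digits in a mixed radix
    ([sparse_links_rich]).

    Wild links. In the remaining case every large set contains a vertex [v] and a
    large set on which the link of [v] has no large homogeneous subset. There one
    chooses an Erdős–Rado sequence [v, u 1, u 2, ...], in which the colour of a
    triple depends on its first two vertices only, and wildness makes the colours
    of the pairs [v, u i] arbitrary ([tagged_run]). These colours label the [u i].
    By Ramsey's theorem the colour of a pair [u i, u j] may be assumed to be a
    function of the two labels. If it is not constant, the first case applies. If
    it is, a second wild vertex with a labelled sequence of its own is appended, and
    [v] is replaced by [p = m / 50] clones, again by supersaturation. Reordering
    the labels of the first sequence then changes the number of edges by multiples
    of [p], and in the second one by multiples of a number that is 1 modulo [p]
    ([uniform_rich]). This again gives a cubic number of values. *)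

Local Open Scope nat_scope.

(** * Counting edges along a list *)

Fixpoint deg (T : Type) (e : T -> T -> T -> bool) (x : T) (l : seq T) : nat :=
  if l is y :: l' then count (e x y) l' + deg e x l' else 0.

Fixpoint cnt3 (T : Type) (e : T -> T -> T -> bool) (l : seq T) : nat :=
  if l is x :: l' then deg e x l' + cnt3 e l' else 0.

Definition sym3 (T : Type) (e : T -> T -> T -> bool) : Prop :=
  (forall x y z, e x y z = e y x z) /\ (forall x y z, e x y z = e x z y).

Definition flip (T : Type) (e : T -> T -> T -> bool) : T -> T -> T -> bool :=
  fun x y z => ~~ e x y z.

Lemma sym3_flip (T : Type) (e : T -> T -> T -> bool) : sym3 e -> sym3 (flip e).
Proof. by case=> h1 h2; split=> x y z; rewrite /flip; [rewrite h1 | rewrite h2]. Qed.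

Lemma deg_cat (T : Type) (e : T -> T -> T -> bool) (x : T) (l1 l2 : seq T) :
  deg e x (l1 ++ l2) =
  deg e x l1 + deg e x l2 + \sum_(y <- l1) count (e x y) l2.
Proof.
elim: l1 => [|y l1 IH] /=; first by rewrite big_nil addn0.
rewrite big_cons count_cat IH; lia.
Qed.

Lemma sum_count_exchange (T : Type) (e : T -> T -> bool) (l1 l2 : seq T) :
  \sum_(y <- l1) count (e y) l2 = \sum_(z <- l2) count (e^~ z) l1.
Proof.
have sc (p : pred T) l : count p l = \sum_(z <- l) p z.
  by elim: l => [|a l IH] /=; rewrite ?big_nil ?big_cons ?IH.
under eq_bigr do rewrite sc.
by rewrite exchange_big /=; apply: eq_bigr => z _; rewrite sc.
Qed.

Lemma cnt3_cat (T : Type) (e : T -> T -> T -> bool) (l1 l2 : seq T) :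
  sym3 e ->
  cnt3 e (l1 ++ l2) =
  cnt3 e l1 + cnt3 e l2 + \sum_(x <- l1) deg e x l2 + \sum_(y <- l2) deg e y l1.
Proof.
case=> h1 h2; elim: l1 => [|x l1 IH] /=.
  by rewrite big_nil !addn0 [X in _ + X]big1 ?addn0.
rewrite deg_cat IH big_cons big_split /= sum_count_exchange.
have -> : \sum_(z <- l2) count ((e x)^~ z) l1 = \sum_(z <- l2) count (e z x) l1.
  by apply: eq_bigr => z _; apply: eq_count => y; rewrite h2 h1.
lia.
Qed.

Lemma deg_flip (T : Type) (e : T -> T -> T -> bool) (x : T) (l : seq T) :
  deg (flip e) x l + deg e x l = 'C(size l, 2).
Proof.
elim: l => [|y l IH] //=; rewrite binS bin1 -IH.
have h : count (flip e x y) l + count (e x y) l = size l.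
  by rewrite addnC -(count_predC (e x y) l); congr (_ + _); apply: eq_count.
by rewrite addnACA h addnC.
Qed.

Lemma cnt3_flip (T : Type) (e : T -> T -> T -> bool) (l : seq T) :
  cnt3 (flip e) l + cnt3 e l = 'C(size l, 3).
Proof.
elim: l => [|y l IH] //=; rewrite binS -IH -(deg_flip e y l); lia.
Qed.

Definition attained (T : eqType) (e : T -> T -> T -> bool) (m f : nat) : Prop :=
  exists l : seq T, [/\ uniq l, size l = m & cnt3 e l = f].

Definition rich (T : eqType) (e : T -> T -> T -> bool) (m q : nat) : Prop :=
  exists (D : finType) (F : D -> nat),
    [/\ injective F, q <= #|D| & forall d, attained e m (F d)].

Lemma attained_flip (T : eqType) (e : T -> T -> T -> bool) (m f : nat) :
  attained (flip e) m f -> f <= 'C(m, 3) /\ attained e m ('C(m, 3) - f).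
Proof.
case=> l [ul sl cl]; have := cnt3_flip e l; rewrite sl cl => h.
by split; [lia | exists l; split => //; lia].
Qed.

Lemma rich_flip (T : eqType) (e : T -> T -> T -> bool) (m q : nat) :
  rich (flip e) m q -> rich e m q.
Proof.
case=> D [F [iF qD vF]]; exists D, (fun d => 'C(m, 3) - F d); split => //.
  move=> d d' h; apply: iF.
  have [h1 _] := attained_flip (vF d); have [h2 _] := attained_flip (vF d'); lia.
by move=> d; case: (attained_flip (vF d)).
Qed.

Definition nsub (T : finType) (k : nat) (S : {set T}) (Q : pred {set T}) : nat :=
  #|[set P : {set T} | [&& P \subset S, #|P| == k & Q P]]|.

(** Pascal's rule, splitting on whether the subset contains [x]. *)
Lemma nsubS (T : finType) (k : nat) (x : T) (S : {set T}) (Q : pred {set T}) :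
  x \notin S ->
  nsub k.+1 (x |: S) Q = nsub k.+1 S Q + nsub k S (fun P => Q (x |: P)).
Proof.
move=> xS; rewrite /nsub -(cardsID [set P : {set T} | x \in P]) addnC.
congr (_ + _).
  apply: eq_card => P; rewrite !inE; case: (boolP (x \in P)) => xP /=.
    by apply/esym/negbTE; apply: contra xS => /andP[/subsetP/(_ x xP)].
  congr (_ && _); apply/idP/idP => [/subsetP h|h].
    apply/subsetP => y yP; have := h y yP; rewrite !inE.
    by case: eqP => // yx; rewrite yx (negbTE xP) in yP.
  exact: subset_trans h (subsetUr _ _).
have inj : {in [set P : {set T} | [&& P \subset S, #|P| == k & Q (x |: P)]] &,
    injective (fun P : {set T} => x |: P)}.
  move=> P P'; rewrite !inE => /andP[PS _] /andP[PS' _] h.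
  have xP : x \notin P by apply: contra xS; apply: subsetP.
  have xP' : x \notin P' by apply: contra xS; apply: subsetP.
  by rewrite -(setU1K xP) -(setU1K xP') h.
rewrite -(card_in_imset inj); apply: eq_card => P; rewrite !inE.
apply/idP/imsetP => [/andP[/and3P[PS /eqP cP QP] xP]|[P' + ->]].
  exists (P :\ x); last by rewrite setD1K.
  rewrite !inE setD1K // QP andbT; apply/andP; split.
    by rewrite subDset.
  by have := cardsD1 x P; rewrite xP cP add1n => /eqP; rewrite eqSS eq_sym.
rewrite inE => /and3P[PS /eqP cP QP].
have xP : x \notin P' by apply: contra xS; apply: subsetP.
by rewrite QP setU11 cardsU1 xP cP eqxx !andbT setUS.
Qed.

Lemma nsub0 (T : finType) (S : {set T}) (Q : pred {set T}) : nsub 0 S Q = Q set0.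
Proof.
rewrite /nsub; case: (boolP (Q set0)) => h.
  rewrite (_ : [set P | _] = [set set0]) ?cards1 //; apply/setP => P.
  rewrite !inE cards_eq0; case: eqP => [->|]; rewrite ?sub0set ?h ?andbF //.
rewrite (_ : [set P | _] = set0) ?cards0 //; apply/setP => P.
by rewrite !inE cards_eq0; case: eqP => [->|]; rewrite ?(negbTE h) ?andbF.
Qed.

Lemma nsub_set0 (T : finType) (k : nat) (Q : pred {set T}) : nsub k.+1 set0 Q = 0.
Proof.
rewrite /nsub (_ : [set P | _] = set0) ?cards0 //; apply/setP => P.
by rewrite !inE subset0; case: eqP => [->|//]; rewrite cards0.
Qed.

(** The edges of a list may be counted as sets: both sides obey the recursion
    that removes the first vertex, then the first vertex of its link. *)
Lemma cnt3_nsub (T : finType) (Q : pred {set T}) (l : seq T) :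
  uniq l ->
  cnt3 (fun x y z => Q [set x; y; z]) l = nsub 3 [set x in l] Q.
Proof.
have n1 : forall Q' (s : seq T), uniq s ->
    count (fun z => Q' [set z]) s = nsub 1 [set x in s] Q'.
  move=> Q'; elim => [|z s IH] /=; first by rewrite set_nil nsub_set0.
  by case/andP=> zs us; rewrite set_cons nsubS ?inE // nsub0 setU0 IH // addnC.
have n2 : forall x (s : seq T), uniq s ->
    deg (fun x y z => Q [set x; y; z]) x s
    = nsub 2 [set x in s] (fun P => Q (x |: P)).
  move=> x; elim => [|z s IH] /=; first by rewrite set_nil nsub_set0.
  case/andP=> zs us; rewrite set_cons nsubS ?inE // -n1 // -IH // addnC.
  by congr (_ + _); apply: eq_count => y; rewrite setUA.
elim: l => [|x l IH] /=; first by rewrite set_nil nsub_set0.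
by case/andP=> xl ul; rewrite set_cons nsubS ?inE // n2 // IH // addnC.
Qed.

(** * Words *)

(** The degree of a vertex [v] over a list of vertices, if the colour of a triple
    containing [v] is the letter of [w] at the first of its two other vertices. *)
Fixpoint lsum (w : seq bool) : nat :=
  if w is t :: w' then t * size w' + lsum w' else 0.

Lemma lsum_cat (u v : seq bool) :
  lsum (u ++ v) = lsum u + count id u * size v + lsum v.
Proof. elim: u => [|t u IH] //=; rewrite IH size_cat /=; case: t => /=; lia. Qed.

Lemma lsum_false (n : nat) : lsum (nseq n false) = 0.
Proof. by elim: n. Qed.

(** The words with [p] letters 0 and [p] letters 1 realise all inversion numbers
    [t < p * p]; if [t = r * p + y] with [y < p], then [r] letters 1 have crossed
    all the letters 0, and one more has crossed [y] of them. *)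
Definition inv_word (p t : nat) : seq bool :=
  nseq (t %/ p) true ++ nseq (p - t %% p) false ++
  true :: nseq (t %% p) false ++ nseq (p.-1 - t %/ p) true.

Lemma inv_wordP (p t : nat) : t < p * p ->
  [/\ size (inv_word p t) = 2 * p, count id (inv_word p t) = p &
      lsum (inv_word p t) = lsum (nseq p true) + t].
Proof.
move=> tp; have p0 : 0 < p by lia.
have yp : t %% p < p by rewrite ltn_mod.
have rp : t %/ p < p by rewrite ltn_divLR.
have et := divn_eq t p; rewrite /inv_word.
set r := t %/ p in rp et *; set y := t %% p in yp et *.
split.
- rewrite !(size_cat, size_nseq, size_cat) /= size_cat !size_nseq; lia.
- rewrite !(count_cat, count_nseq) /= !(count_cat, count_nseq) /=; lia.
rewrite {}et (_ : nseq p true = nseq (r + (1 + (p.-1 - r))) true); last by congr nseq; lia.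
rewrite !nseqD !lsum_cat /= !lsum_cat !lsum_false !count_nseq /=.
rewrite !(size_cat, size_nseq, size_cat) /= size_cat !size_nseq.
nia.
Qed.

(** [Fw g w] is the number of edges of a list of vertices labelled by [w] if [g]
    gives the colour of a triple in terms of the labels of its first two
    vertices; [Dw g t] is the contribution of a first vertex labelled [t]. *)
Fixpoint Dw (g : bool -> bool -> bool) (t : bool) (w : seq bool) : nat :=
  if w is t' :: w' then g t t' * size w' + Dw g t w' else 0.

Fixpoint Fw (g : bool -> bool -> bool) (w : seq bool) : nat :=
  if w is t :: w' then Dw g t w' + Fw g w' else 0.

Lemma Dw_swap g t pre w :
  Dw g t (pre ++ true :: false :: w) + g t false =
  Dw g t (pre ++ false :: true :: w) + g t true.
Proof.
elim: pre => [|a pre IH] /=; first by nia.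
rewrite !size_cat /=; lia.
Qed.

(** Interchanging two adjacent letters: only the indegrees of these two letters,
    and their numbers of followers, are affected. *)
Lemma Fw_swap g pre w :
  Fw g (pre ++ true :: false :: w) + g false false * count negb pre
    + g true false * count id pre + g false true * size w =
  Fw g (pre ++ false :: true :: w) + g false true * count negb pre
    + g true true * count id pre + g true false * size w.
Proof.
elim: pre => [|a pre IH] /=; first by nia.
have := Dw_swap g a pre w.
by case: a => /=; case: (g _ _) IH; case: (g _ _); case: (g _ _);
  case: (g _ _) => /=; lia.
Qed.

Local Open Scope ring_scope.

(** The change of [Fw g] when two adjacent letters 01 become 10, if [n0] letters 0
    and [n1] letters 1 precede them and [k] letters follow. *)
Definition dlt (g : bool -> bool -> bool) (n0 n1 k : int) : int :=
  ((g false true : nat)%:Z - (g false false : nat)%:Z) * n0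
  + ((g true true : nat)%:Z - (g true false : nat)%:Z) * n1
  + ((g true false : nat)%:Z - (g false true : nat)%:Z) * k.

Lemma Fw_swapZ g pre w :
  (Fw g (pre ++ true :: false :: w))%:Z - (Fw g (pre ++ false :: true :: w))%:Z
  = dlt g (count negb pre)%:Z (count id pre)%:Z (size w)%:Z.
Proof. have := Fw_swap g pre w; rewrite /dlt; nia. Qed.

(** Moving a letter 1 to the left across [y] letters 0 takes [y] exchanges, and
    [sg] records that they all change [Fw g] in the same direction. *)
Lemma Fw_move g pre y w (sg D : int) :
  (forall i : nat, (i < y)%N ->
     D <= sg * dlt g (count negb pre + i)%N%:Z (count id pre)%:Z
                 (size w + (y.-1 - i))%N%:Z) ->
  y%:Z * D <= sg * ((Fw g (pre ++ true :: nseq y false ++ w))%:Z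
                    - (Fw g (pre ++ nseq y false ++ true :: w))%:Z).
Proof.
elim: y pre => [|y IH] pre H /=; first by rewrite subrr mul0r mulr0.
have h0 := H 0%N isT; rewrite addn0 subn0 /= in h0.
have := Fw_swapZ g pre (nseq y false ++ w).
rewrite size_cat size_nseq addnC => sw.
have := IH (pre ++ [:: false]); rewrite -!catA /= => {}IH.
have {}IH := IH _; move: IH.
rewrite !count_cat /= => IH; have {}IH : y%:Z * D <= sg *
  ((Fw g (pre ++ false :: true :: nseq y false ++ w))%:Z -
   (Fw g (pre ++ false :: nseq y false ++ true :: w))%:Z).
  apply: IH => i iy; have := H i.+1 iy.
  rewrite (_ : (count negb pre + i.+1 = count negb pre + (1 + 0) + i)%N); last by lia.
  rewrite (_ : (y.+1.-1 - i.+1 = y.-1 - i)%N); last by lia.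
  by rewrite !addn0.
have -> : (Fw g (pre ++ [:: true, false & nseq y false ++ w]))%:Z =
  (Fw g (pre ++ [:: false, true & nseq y false ++ w]))%:Z +
   dlt g (count negb pre) (count id pre) (size w + y)%N by lia.
rewrite (_ : y.+1%:Z * D = y%:Z * D + D); last by rewrite intS; ring.
rewrite [X in _ <= X](_ : _ = sg *
  ((Fw g (pre ++ false :: true :: nseq y false ++ w))%:Z -
   (Fw g (pre ++ false :: nseq y false ++ true :: w))%:Z) +
   sg * dlt g (count negb pre) (count id pre) (size w + y)%N); last by ring.
exact: lerD.
Qed.

(** Each bit is coded by the order of the letters 0 and 1 in a unit. Both codes
    have the same numbers of letters, so that a unit does not affect the changes
    made by later ones; the letters 0 in between serve to tune these changes. *)
Fixpoint units (x : nat) (bits : seq bool) : seq bool :=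
  if bits is b :: bits' then b :: ~~ b :: nseq x false ++ units x bits' else [::].

Lemma count_units x bits :
  count negb (units x bits) = (size bits * x.+1)%N /\
  count id (units x bits) = size bits.
Proof.
elim: bits => [|b bits [IH1 IH2]] //=; rewrite !count_cat IH1 IH2 !count_nseq /=.
by case: b => /=; split; lia.
Qed.

Lemma size_units x bits : size (units x bits) = (size bits * x.+2)%N.
Proof. by elim: bits => [|b bits IH] //=; rewrite size_cat size_nseq IH; lia. Qed.

(** The effect of turning a unit from 01 into 10 is affine in the number of units
    that follow it, hence only [count id bits] and [lsum bits] matter. *)
Lemma Fw_units g x pre rest bits :
  (Fw g (pre ++ units x bits ++ rest))%:Z =
  (Fw g (pre ++ units x (nseq (size bits) false) ++ rest))%:Z
  + dlt g ((count negb pre)%:Z + ((size bits)%:Z - 1) * (1 + x%:Z))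
          ((count id pre)%:Z + (size bits)%:Z - 1)
          ((size rest)%:Z + x%:Z) * (count id bits)%:Z
  - dlt g (1 + x%:Z) 1 (- (2 + x%:Z)) * (lsum bits)%:Z.
Proof.
elim: bits pre => [|b bits IH] pre; first by rewrite /= mulr0 mulr0 subr0 addr0.
have e (c : bool) bs : pre ++ units x (c :: bs) ++ rest =
    (pre ++ c :: ~~ c :: nseq x false) ++ units x bs ++ rest.
  by rewrite /= -!catA.
rewrite e IH -e /= !count_cat /= !count_nseq /=.
have -> : (Fw g (pre ++ [:: b, ~~ b & nseq x false ++ units x (nseq (size bits) false)] ++ rest))%:Z
  = (Fw g (pre ++ [:: false, true & nseq x false ++ units x (nseq (size bits) false)] ++ rest))%:Z
  + b%:Z * dlt g (count negb pre)%:Z (count id pre)%:Z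
      (x + size bits * x.+2 + size rest)%N%:Z.
  case: b => /=; last by rewrite mul0r addr0.
  rewrite mul1r; have := Fw_swapZ g pre ((nseq x false ++ units x (nseq (size bits) false)) ++ rest).
  rewrite !size_cat !size_nseq size_units size_nseq; lia.
rewrite !PoszD !PoszM /dlt.
have -> : (x.+2)%:Z = x%:Z + 2 by lia.
have -> : (size bits).+1%:Z = (size bits)%:Z + 1 by lia.
have -> : (nat_of_bool (~~ b))%:Z = 1 - b%:Z by case: (b).
have -> : (nat_of_bool (~~ ~~ b))%:Z = b%:Z by case: (b).
ring.
Qed.

(** Passing from [r] to [r.+1] moves a letter 1 across [p] letters 0. *)
Definition coarse (p r : nat) : seq bool :=
  nseq r true ++ nseq p false ++ nseq (p - r) true.

Lemma size_coarse p r : (r <= p)%N -> size (coarse p r) = (2 * p)%N.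
Proof. by rewrite /coarse !size_cat !size_nseq; lia. Qed.

Definition nonconst (g : bool -> bool -> bool) : Prop :=
  exists a b c d, g a b <> g c d.

Lemma nonconstE g : nonconst g ->
  ~ (g false false = g false true /\ g false false = g true false /\
     g false false = g true true).
Proof. by case=> [] [] [] [] [] [] [] [] h [h1 [h2 h3]]; apply: h; congruence. Qed.

(** One more letter 0 between two units changes the step of the fine moves by
    [2 g01 - g00 - g10], and if the step vanishes with and without this letter,
    then [g] is constant. *)
Lemma unit_step g : nonconst g ->
  exists2 x : nat, (x <= 1)%N &
    let al := dlt g (1 + x%:Z) 1 (- (2 + x%:Z)) in al != 0 /\ `|al| <= 6.
Proof.
move/nonconstE => h; rewrite /dlt.
case E1: (g false false) h; case E2: (g false true);
case E3: (g true false); case E4: (g true true) => h /=;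
  try (by exfalso; apply: h);
  by [exists 0%N; lia | exists 1%N; lia].
Qed.

(** As [g] is not constant, one of the coefficients of [dlt g] is nonzero; a long
    constant block, placed before or after the moving letters, makes the
    corresponding term dominate in all the exchanges of the coarse moves. *)
Lemma coarse_step g p K : nonconst g -> (42 * p <= K)%N ->
  exists pre suf : seq bool, exists sg : int,
    [/\ (size pre + size suf)%N = K, `|sg| = 1 &
    forall u0 u1 i k : nat, (u0 <= 4 * p)%N -> (u1 <= 3 * p)%N -> (i <= p)%N ->
      (k <= 2 * p)%N ->
      (35 * p)%N%:Z <= sg * dlt g (count negb pre + (u0 + i))%N%:Z
         (count id pre + u1)%N%:Z (size suf + k)%N%:Z].
Proof.
move=> h pK; have [h1|/eqP h1] := eqVneq (g false true) (g false false); last first.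
  exists (nseq K false), [::], (if g false true then 1 else -1).
  rewrite /= size_nseq addn0; split; [by []|by case: ifP|] => u0 u1 i k ? ? ? ?.
  rewrite !count_nseq /= /dlt; move: h1.
  by case: (g false false); case: (g false true); case: (g true false);
    case: (g true true) => //= _; lia.
have [h2|/eqP h2] := eqVneq (g true true) (g true false); last first.
  exists (nseq K true), [::], (if g true true then 1 else -1).
  rewrite /= size_nseq addn0; split; [by []|by case: ifP|] => u0 u1 i k ? ? ? ?.
  rewrite !count_nseq /= /dlt; move: h1 h2.
  by case: (g false false); case: (g false true); case: (g true false);
    case: (g true true) => //= _ _; lia.
exists [::], (nseq K false), (if g true false then 1 else -1).
rewrite /= size_nseq add0n; split; [by []|by case: ifP|] => u0 u1 i k ? ? ? ?.
have := nonconstE h; rewrite /dlt /=; move: h1 h2.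
by case: (g false false); case: (g false true); case: (g true false);
  case: (g true true) => //= _ _ hh; (try (exfalso; apply: hh; by [])); lia.
Qed.

(** With [p] flipped units among [2 * p], the fine moves produce [p ^ 2] terms of
    an arithmetic progression of step at most 6. Each coarse move consists
    of [p] exchanges of size at least [35 * p], hence it is longer than the whole
    progression, and no value is obtained twice. *)
Lemma words_rich (T : eqType) (e : T -> T -> T -> bool) g (p m : nat) :
  nonconst g -> (50 * p <= m)%N ->
  (forall w, size w = m -> attained e m (Fw g w)) -> rich e m (p ^ 3).
Proof.
move=> ng pm hval.
have [x x1 [al0 al6]] := unit_step ng.
set al := dlt _ _ _ _ in al0 al6.
(* The constant block fills the word up to length [m]. *)
pose K := (m - (2 * p * x.+2 + 2 * p))%N.
have [|pre [suf [sg [sK sg1 cs]]]] := @coarse_step g p K ng; first by rewrite /K; nia.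
pose W bits r := pre ++ units x bits ++ coarse p r ++ suf.
pose H r := (Fw g (W (nseq (2 * p) false) r))%:Z.
have step r : (r < p)%N -> (35 * p * p)%N%:Z <= sg * (H r.+1 - H r).
  move=> rp; have := @Fw_move g (pre ++ units x (nseq (2 * p) false) ++ nseq r true)
    p (nseq (p - r.+1) true ++ suf) sg (35 * p)%N%:Z.
  have [c1 c2] := count_units x (nseq (2 * p) false).
  rewrite !count_cat c1 c2 !count_nseq /= size_nseq size_cat size_nseq.
  have e1 : (pre ++ units x (nseq (2 * p) false) ++ nseq r true) ++
      true :: nseq p false ++ nseq (p - r.+1) true ++ suf
      = W (nseq (2 * p) false) r.+1.
    rewrite /W /coarse -!catA.
    have <- : nseq r true ++ [:: true] = nseq r.+1 true.
      by rewrite -[[:: true]]/(nseq 1 true) -nseqD addn1.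
    by rewrite -!catA.
  have e2 : (pre ++ units x (nseq (2 * p) false) ++ nseq r true) ++
      nseq p false ++ true :: nseq (p - r.+1) true ++ suf
      = W (nseq (2 * p) false) r.
    rewrite /W /coarse -!catA (_ : (p - r = (p - r.+1).+1)%N) //; last by lia.
  rewrite e1 e2 mul0n mul1n addn0 => hm; rewrite /H.
  apply: le_trans (hm _); first by rewrite -PoszM lez_nat mulnC leqnn.
  move=> i ip; have := cs (2 * p * x.+1)%N (2 * p + r)%N i (p - r.+1 + (p.-1 - i))%N.
  rewrite !addnA [(p - r.+1 + size suf)%N]addnC; apply; nia.
have far r r' : (r < r' <= p)%N -> (35 * p * p)%N%:Z <= sg * (H r' - H r).
  elim: r' => [|r' IH]; first by lia.
  move=> /andP[rr rp]; have st := step r' rp.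
  have [->//|rr'] := eqVneq r r'.
  have := IH _; have -> : (r < r' <= p)%N by lia.
  move/(_ isT) => h.
  have -> : sg * (H r'.+1 - H r) = sg * (H r' - H r) + sg * (H r'.+1 - H r') by ring.
  by lia.
pose C := dlt g ((count negb pre)%:Z + ((2 * p)%:Z - 1) * (1 + x%:Z))
          ((count id pre)%:Z + (2 * p)%:Z - 1)
          ((2 * p + size suf)%N%:Z + x%:Z) * p%:Z
     - al * (lsum (nseq p true))%:Z.
have FE r t : (r <= p)%N -> (t < p * p)%N ->
    (Fw g (W (inv_word p t) r))%:Z = H r + C - al * t%:Z.
  move=> rp tp; have [s1 s2 s3] := inv_wordP tp.
  rewrite /W Fw_units s1 s2 s3 size_cat size_coarse // /C -/al /H /W PoszD.
  by ring.
pose F (d : 'I_p * 'I_(p * p)) := Fw g (W (inv_word p d.2) d.1).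
exists ('I_p * 'I_(p * p))%type, F; split.
- move=> [r t] [r' t'] /(congr1 Posz); rewrite /F /=.
  rewrite !FE ?ltn_ord ?(ltnW (ltn_ord _)) //.
  have tp := ltn_ord t; have tp' := ltn_ord t' => eqF.
  have sm (a b : 'I_p) (k l : 'I_(p * p)) : H a + C - al * (k : nat)%:Z =
      H b + C - al * (l : nat)%:Z -> (a < b)%N -> False.
    move=> E ab; have ap := ltn_ord b; have := far a b.
    have -> : (a < b <= p)%N by lia.
    move/(_ isT); have -> : H b - H a = al * ((l : nat)%:Z - (k : nat)%:Z).
      apply: (@addrI _ (H a - al * (l : nat)%:Z + C)); rewrite mulrBr.
      transitivity (H b + C - al * (l : nat)%:Z); first by ring.
      by rewrite -E; ring.
    have kp := ltn_ord k; have lp := ltn_ord l.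
    move=> far1; have : `|sg * (al * ((l : nat)%:Z - (k : nat)%:Z))| <= 6 * (p * p)%N%:Z.
      by rewrite !normrM sg1 mul1r; apply: ler_pM => //; lia.
    by nia.
  have [rr|rr|/val_inj rr] := ltngtP r r'; first by case: (sm _ _ _ _ eqF rr).
    by case: (sm _ _ _ _ (esym eqF) rr).
  congr pair => //; apply: val_inj; move: eqF; rewrite rr => /addrI/oppr_inj.
  by move/(mulfI al0) => [].
- by rewrite card_prod !card_ord !expnS expn0 muln1.
- move=> [r t]; apply: hval; have rp := ltnW (ltn_ord r); have tp := ltn_ord t.
  have [s1 _ _] := inv_wordP tp.
  have px : (2 * p * x.+2 <= 6 * p)%N by nia.
  rewrite /W /= !size_cat size_units s1 !size_nseq.
  by move: sK px; rewrite /K; set q := (2 * p * x.+2)%N; lia.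
Qed.

Local Open Scope nat_scope.

(** * Supersaturation and pigeonholes *)

Lemma pigeonhole_seq (T : Type) (C : finType) (f : T -> C) (s : seq T) : 0 < #|C| ->
  exists c, size s <= #|C| * size [seq y <- s | f y == c].
Proof.
move=> C0; apply: contrapT => no.
have lt c : #|C| * size [seq y <- s | f y == c] < size s.
  by rewrite ltnNge; apply/negP => h; apply: no; exists c.
have : \sum_(c : C) #|C| * size [seq y <- s | f y == c] < \sum_(c : C) size s.
  have [c0 _] : exists c0 : C, true by case/card_gt0P: C0 => c0; exists c0.
  rewrite (bigD1 c0) //= [X in _ < X](bigD1 c0) //= -addSn.
  by apply: leq_add; [exact: lt | apply: leq_sum => c _; apply: ltnW].
rewrite -big_distrr /= sum_nat_const ltn_pmul2l //.
suff -> : \sum_(c : C) size [seq y <- s | f y == c] = size s by rewrite ltnn.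
elim: s {no lt} => [|y s IH] /=; first by rewrite big1.
rewrite -IH -add1n (bigD1 (f y)) //= eqxx /= addSn (bigD1 (f y) (P := predT)) //=.
by rewrite add1n; congr (_ + _).+1; apply: eq_bigr => c /negbTE; rewrite eq_sym => ->.
Qed.

Lemma pigeonhole (T C : finType) (Z : {set T}) (f : T -> C) : 0 < #|C| ->
  exists c, #|Z| <= #|C| * #|[set x in Z | f x == c]|.
Proof.
move=> /(pigeonhole_seq f (enum Z))[c]; rewrite -cardE => cZ; exists c.
apply: leq_trans cZ _; rewrite leq_mul2l cardE; apply/orP; right; apply: eq_leq.
apply/perm_size/uniq_perm; [exact: filter_uniq (enum_uniq _)|exact: enum_uniq|].
by move=> x; rewrite mem_filter !mem_enum inE andbC.
Qed.

Lemma card_supersets (T : finType) (W B : {set T}) (t : nat) :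
  B \subset W ->
  #|[set A : {set T} | [&& A \subset W, #|A| == t & B \subset A]]|
    <= 'C(#|W| - #|B|, t - #|B|).
Proof.
move=> BW; have -> : #|W| - #|B| = #|W :\: B|.
  by rewrite cardsD (setIidPr BW).
rewrite -cards_draws.
have inj : {in [set A : {set T} | [&& A \subset W, #|A| == t & B \subset A]] &,
    injective (fun A => A :\: B)}.
  move=> A A'; rewrite !inE => /and3P[_ _ h] /and3P[_ _ h'] E.
  by rewrite -(setID A B) -(setID A' B) (setIidPr h) (setIidPr h') E.
rewrite -(card_in_imset inj); apply: subset_leq_card.
apply/subsetP => _ /imsetP[A + ->]; rewrite !inE => /and3P[AW /eqP <- BA].
by rewrite setSD //= cardsD (setIidPr BA).
Qed.

Lemma bin_ffact_sub (n t k : nat) : k <= t -> t <= n ->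
  'C(n, t) * t ^_ k = n ^_ k * 'C(n - k, t - k).
Proof.
move=> kt tn; apply/eqP.
rewrite -(eqn_pmul2r (fact_gt0 (t - k))) -(eqn_pmul2r (fact_gt0 (n - t))).
rewrite -(mulnA 'C(n, t)) ffact_fact // -mulnA bin_fact //.
have -> : n - t = n - k - (t - k) by lia.
rewrite -!mulnA bin_fact; last by lia.
by rewrite ffact_fact //; lia.
Qed.

(** A configuration is contained in a proportion of about [(t / #|W|) ^ k.+1] of all
    [t]-subsets of [W], so that about [(#|W| / t) ^ k.+1] configurations are needed
    to meet all of them. As there are at most [#|W| ^ k] choices of [h], some [h] is
    completed by about [#|W| / t ^ k.+1] vertices [x]. *)
Lemma supersaturation (T : finType) (W : {set T}) (t k z : nat)
    (Q : T -> seq T -> Prop) :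
  (forall A : {set T}, A \subset W -> #|A| = t -> exists x h,
     [/\ uniq (x :: h), {subset x :: h <= A}, size h = k & Q x h]) ->
  0 < z -> t <= #|W| -> t ^ k.+1 * z + k <= #|W| ->
  exists h (Z : {set T}), [/\ size h = k, uniq h & {subset h <= W}] /\
    [/\ Z \subset W, z <= #|Z| & forall x, x \in Z -> Q x h /\ x \notin h].
Proof.
move=> hA z0 tW zW.
pose P := [set p : T * k.-tuple T | [&& uniq (p.1 :: p.2),
   all [in W] (p.1 :: p.2) & `[< Q p.1 p.2 >]]].
pose Zh (h : k.-tuple T) := [set x | (x, h) \in P].
apply: contrapT => no.
have Zlt h : #|Zh h| < z.
  rewrite ltnNge; apply/negP => zZ; apply: no; exists h, (Zh h).
  have [x0] : exists x, x \in Zh h by apply/card_gt0P; lia.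
  rewrite !inE /= => /and3P[/andP[_ uh] /andP[_ ah] _].
  rewrite size_tuple; split; split => //; first exact/allP.
  - by apply/subsetP => x; rewrite !inE /= => /and3P[_ /andP[]].
  - by move=> x; rewrite !inE /= => /and3P[/andP[? _] _ /asboolP].
have kt : k.+1 <= t.
  have [A AW cA] : exists2 A : {set T}, A \subset W & #|A| = t.
    have : 0 < #|[set A : {set T} | A \subset W & #|A| == t]|.
      by rewrite cards_draws bin_gt0.
    by case/card_gt0P => A; rewrite !inE => /andP[? /eqP ?]; exists A.
  have [x [h [u s <- _]]] := hA A AW cA; rewrite -cA.
  by rewrite -[_.+1]/(size (x :: h)) -(card_uniqP u); apply/subset_leq_card/subsetP.
(* Each [t]-set contains a configuration, and each configuration is contained in
   a bounded number of [t]-sets. *)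
have PC : 'C(#|W|, t) <= #|P| * 'C(#|W| - k.+1, t - k.+1).
  rewrite -cards_draws -sum1_card.
  pose S (p : T * k.-tuple T) := [set y in p.1 :: p.2].
  apply: (@leq_trans (\sum_(A in [set A : {set T} | A \subset W & #|A| == t])
      \sum_(p in P) (S p \subset A))).
    apply: leq_sum => A; rewrite inE => /andP[AW /eqP cA].
    have [x [h [u s sh q]]] := hA A AW cA.
    have sh' : size h == k by apply/eqP.
    rewrite (bigD1 (x, Tuple sh')) /=; last first.
      rewrite inE /= -[_ && uniq h]/(uniq (x :: h)) u /=; apply/andP; split.
        apply/(@allP _ _ (x :: h)) => y yh; apply: (subsetP AW); exact: s.
      exact/asboolP.
    rewrite (_ : S _ \subset A) //; apply/subsetP => y; rewrite inE; exact: s.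
  rewrite exchange_big /= -sum_nat_const; apply: leq_sum => p pP.
  have [up ap] : uniq (p.1 :: p.2) /\ all [in W] (p.1 :: p.2).
    by move: pP; rewrite inE => /and3P[].
  have cS : #|S p| = k.+1 by rewrite cardsE (card_uniqP up) /= size_tuple.
  rewrite -cS; apply: leq_trans (card_supersets _ _); last first.
    by apply/subsetP => y; rewrite inE; apply/allP.
  rewrite -sum1_card big_mkcond [X in _ <= X]big_mkcond /=.
  by apply: leq_sum => A _; rewrite !inE; case: (_ \subset W) => //=;
    case: (_ == t) => //=; case: (_ \subset A).
(* On the other hand, there are fewer than [z] candidates for each [h]. *)
have Pz : #|P| <= #|W| ^_ k * z.-1.
  rewrite -(@card_uniq_tuples _ _ [in W]) -sum1_card -sum_nat_const.
  rewrite (eq_bigr (fun p => \sum_(h : k.-tuple T) (p.2 == h))) /=; last first.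
    move=> p _; rewrite (bigD1 p.2) //= eqxx big1 // => h /negbTE.
    by rewrite eq_sym => ->.
  rewrite exchange_big /= [X in _ <= X]big_mkcond /=; apply: leq_sum => h _.
  have sZ : \sum_(p in P) (p.2 == h) = #|Zh h|.
    rewrite -sum1_card -big_mkcondr /= (reindex_onto (fun x => (x, h)) fst) /=.
      by apply: eq_bigl => x; rewrite !inE /= !eqxx !andbT.
    by case=> x h' /= /andP[_ /eqP ->].
  have [_|no'] := ifP; first by rewrite sZ; have := Zlt h; lia.
  rewrite sZ leqn0 cards_eq0; apply/eqP/setP => x; rewrite !inE /=.
  apply/negbTE/negP => /and3P[/andP[_ u] /andP[_ a] _].
  by move: no'; rewrite inE u a.
have C0 : 0 < 'C(#|W| - k.+1, t - k.+1) by rewrite bin_gt0; lia.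
have main : #|W| ^_ k.+1 <= #|P| * t ^_ k.+1.
  rewrite -(leq_pmul2r C0) -bin_ffact_sub // mulnAC leq_mul2r PC orbT //.
have tf j : t ^_ j <= t ^ j.
  elim: j => [|j IH]; first by rewrite ffactn0.
  by rewrite ffactnSr expnSr leq_mul ?leq_subr.
have W0 : 0 < #|W| ^_ k by rewrite ffact_gt0; lia.
have : #|W| ^_ k * (#|W| - k) <= #|W| ^_ k * (z.-1 * t ^ k.+1).
  rewrite -ffactnSr; apply: leq_trans main _; rewrite mulnA.
  exact: leq_mul.
rewrite leq_pmul2l //; have := expn_gt0 t k.+1.
have -> : 0 < t by lia.
by move=> /= t0; nia.
Qed.

(** * Sparse links *)

Definition lnk (T : finType) (e : T -> T -> T -> bool) (b : bool) (v : T)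
    (A : {set T}) : Prop :=
  forall x y, x \in A -> y \in A -> x != y -> e v x y = b.

Lemma lnk_sub (T : finType) (e : T -> T -> T -> bool) b v (A B : {set T}) :
  A \subset B -> lnk e b v B -> lnk e b v A.
Proof. by move=> /subsetP AB h x y xA yA; apply: h; apply: AB. Qed.

Lemma deg_lnkE (T : finType) (e : T -> T -> T -> bool) b v (A : {set T}) l :
  uniq l -> {subset l <= A} -> lnk e b v A ->
  deg e v l = lsum (nseq (size l) b).
Proof.
move=> ul sl hA; elim: l ul sl => [|x l IH] //= /andP[xl ul] sl.
rewrite IH // => [|y yl]; last by apply: sl; rewrite inE yl orbT.
rewrite size_nseq; congr (_ + _).
rewrite (eq_in_count (a2 := fun=> b)) => [|y yl].
  by case: (b); rewrite /= ?mul1n ?mul0n ?count_predT ?count_pred0.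
rewrite hA ?sl ?inE ?eqxx ?yl ?orbT //.
by apply: contraNneq xl => ->.
Qed.

Lemma deg_lnk (T : finType) (e : T -> T -> T -> bool) v (A : {set T}) l :
  uniq l -> {subset l <= A} -> lnk e false v A -> deg e v l = 0.
Proof. by move=> ul lA hA; rewrite (deg_lnkE ul lA hA) lsum_false. Qed.

(** Sizes are measured in powers of a base [s]. The first condition is stated for
    all radices [r], so that it can be applied repeatedly: a set of size
    [s ^ (w * j)] contains one of size [s ^ j]. The second condition excludes
    large independent sets of [e]. *)
Definition sparse_links (T : finType) (e : T -> T -> T -> bool) (W : {set T})
    (s w : nat) : Prop :=
  (forall v (U : {set T}) r, v \in W -> U \subset W -> v \notin U ->
     s <= r -> r ^ w <= #|U| ->
     exists A : {set T}, [/\ A \subset U, lnk e false v A & r <= #|A|])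
  /\ (forall A : {set T}, A \subset W -> s <= #|A| ->
     exists x y z, [/\ uniq [:: x; y; z], {subset [:: x; y; z] <= A} & e x y z]).

(** One passage to a subset for each vertex of [h]. *)
Lemma shrink_links (T : finType) (e : T -> T -> T -> bool) (W : {set T}) s w
    (h : seq T) (Z : {set T}) j :
  sparse_links e W s w -> 0 < w -> 0 < s -> {subset h <= W} -> Z \subset W ->
  (forall y, y \in h -> y \notin Z) -> 0 < j -> s ^ (w ^ size h * j) <= #|Z| ->
  exists Z' : {set T}, [/\ Z' \subset Z, s ^ j <= #|Z'| &
    forall y, y \in h -> lnk e false y Z'].
Proof.
move=> [sp _] w0 s0; elim: h Z => [|y h IH] Z hW ZW hZ j0 zZ.
  by exists Z; split => //; move: zZ; rewrite mul1n.
have e1 : s ^ (w ^ size (y :: h) * j) = (s ^ (w ^ size h * j)) ^ w.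
  by rewrite -expnM /= expnS; congr (_ ^ _); lia.
have k1 : 0 < w ^ size h * j by rewrite muln_gt0 expn_gt0 w0.
have [A [AZ lA cA]] : exists A : {set T},
    [/\ A \subset Z, lnk e false y A & s ^ (w ^ size h * j) <= #|A|].
  apply: (sp y) => //; first by apply: hW; rewrite mem_head.
  - by apply: hZ; rewrite mem_head.
  - by rewrite -{1}(expn1 s) leq_pexp2l.
  - by rewrite -e1.
have [|||Z' [ZA cZ lZ]] := IH A _ _ _ j0 cA.
- by move=> u uh; apply: hW; rewrite inE uh orbT.
- exact: subset_trans AZ ZW.
- move=> u uh; apply: contra (hZ u _); last by rewrite inE uh orbT.
  exact: (subsetP AZ).
exists Z'; split => //; first exact: subset_trans ZA AZ.
by move=> u; rewrite inE => /orP[/eqP ->|/lZ //]; apply: lnk_sub lA.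
Qed.

(** Supersaturation provides many candidates for the distinguished vertex [x];
    they are then shrunk to a set that is independent in all the links of [h]. *)
Lemma many_completions (T : finType) (e : T -> T -> T -> bool) (W : {set T})
    s w k j1 j2 (Q : T -> seq T -> Prop) (A : {set T}) :
  sparse_links e W s w -> 0 < w -> 1 < s -> 0 < j2 ->
  (forall B : {set T}, B \subset W -> s ^ j1 <= #|B| -> exists x h,
     [/\ uniq (x :: h), {subset x :: h <= B}, size h = k & Q x h]) ->
  A \subset W -> s ^ (j1 * k.+1 + w ^ k * j2 + k) <= #|A| ->
  exists h (Z : {set T}), [/\ size h = k, uniq h & {subset h <= A}] /\
    [/\ Z \subset A, s ^ j2 <= #|Z|, forall x, x \in Z -> Q x h /\ x \notin h &
        forall y, y \in h -> lnk e false y Z].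
Proof.
move=> sp w0 s1 j20 hQ AW cA.
have s0 : 0 < s by lia.
have t1 : s ^ j1 <= #|A|.
  by apply: leq_trans cA; rewrite leq_pexp2l //; nia.
have z0 : 0 < s ^ (w ^ k * j2) by rewrite expn_gt0 s0.
have bd : (s ^ j1) ^ k.+1 * s ^ (w ^ k * j2) + k <= #|A|.
  apply: leq_trans cA; rewrite -expnM !expnD.
  have : k < s ^ k by rewrite ltn_expl.
  have : 0 < s ^ (j1 * k.+1) * s ^ (w ^ k * j2) by rewrite muln_gt0 !expn_gt0 s0.
  by move: (_ * _) (s ^ k) => a b; nia.
have [|h [Z [[sh uh hA] [ZA cZ ZQ]]]] :=
  @supersaturation T A (s ^ j1) k (s ^ (w ^ k * j2)) Q _ z0 t1 bd.
  by move=> B BA cB; apply: hQ; rewrite ?cB // (subset_trans BA AW).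
have [|||||Z' [ZZ cZ' lZ]] := shrink_links (h := h) (Z := Z) (j := j2) sp w0 s0.
- by move=> y /hA; apply/subsetP.
- exact: subset_trans ZA AW.
- by move=> y yh; apply/negP => /ZQ[_ /negP].
- by [].
- by rewrite sh.
exists h, Z'; split => //; split => //; first exact: subset_trans ZZ ZA.
by move=> x xZ; apply: ZQ; apply: (subsetP ZZ).
Qed.

(** Unavoidable configurations: [k] vertices spanning [f] edges, and a
    distinguished vertex [x], lying in [d] edges with them, which is the place
    where other configurations are substituted. The exponent [j] is uniform in the
    graph and in the base. *)
Definition unav (w j k f d : nat) : Prop :=
  forall (T : finType) (e : T -> T -> T -> bool) (W : {set T}) (s : nat),
  sym3 e -> sparse_links e W s w -> 1 < s ->
  forall A : {set T}, A \subset W -> s ^ j <= #|A| -> exists x h,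
    [/\ uniq (x :: h), {subset x :: h <= A}, size h = k &
        cnt3 e h = f /\ deg e x h = d].

Lemma unav0 w : unav w 0 0 0 0.
Proof.
move=> T e W s _ _ _ A _; rewrite expn0 => /card_gt0P[x xA].
by exists x, [::]; split => // y; rewrite inE => /eqP ->.
Qed.

Lemma unav1 w : unav w 1 1 0 0.
Proof.
move=> T e W s _ _ s1 A _; rewrite expn1 => sA.
have /card_gt1P[x [y [xA yA xy]]] : 1 < #|A| by lia.
exists x, [:: y]; split => //; first by rewrite /= inE xy.
by move=> u; rewrite !inE => /orP[] /eqP ->.
Qed.

Lemma subset_cat_seq (T : eqType) (x : T) (h h' : seq T) (A : {pred T}) :
  {subset h <= A} -> {subset x :: h' <= A} -> {subset x :: h ++ h' <= A}.
Proof.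
move=> h1 h2 y; rewrite inE mem_cat => /or3P[/eqP ->|/h1 //|yh].
  by apply: h2; rewrite mem_head.
by apply: h2; rewrite inE yh orbT.
Qed.

(** The second configuration is put in the place of the distinguished vertex of
    the first one. Each of its [k'] vertices inherits [d] edges; there are no
    edges with one vertex in the first configuration and two in the second one,
    because the links of the first one are empty where the second one lies. *)
Lemma unav_comp w j1 j2 k f d k' f' d' : 0 < w ->
  unav w j1 k f d -> unav w j2 k' f' d' ->
  exists j, unav w j (k + k') (f + f' + k' * d) (d + d').
Proof.
move=> w0 u1 u2; exists (j1 * k.+1 + w ^ k * j2.+1 + k).
move=> T e W s sy sp s1 A AW cA.
have [|h [Z [[sh uh hA] [ZA cZ ZQ lZ]]]] := @many_completions T e W s w k j1 j2.+1
  (fun x h => cnt3 e h = f /\ deg e x h = d) A sp w0 s1 isT _ AW cA.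
  by move=> B BW cB; apply: (u1 T e W s).
have ZW := subset_trans ZA AW.
have [|x [h' [uh' hZ sh' [ch' dh']]]] := u2 T e W s sy sp s1 Z ZW.
  by apply: leq_trans cZ; rewrite leq_pexp2l // ltnW.
have xZ : x \in Z by apply: hZ; rewrite mem_head.
have h'Z : {subset h' <= Z} by move=> y yh; apply: hZ; rewrite inE yh orbT.
have [[ch dh] xh] := ZQ x xZ.
have disj : ~~ has [in h] h' by apply/hasPn => y /h'Z /ZQ[].
move: uh'; rewrite /= => /andP[xh' uh'].
exists x, (h ++ h'); split.
- by rewrite /= mem_cat negb_or xh xh' cat_uniq uh uh' disj.
- apply: subset_cat_seq => // y; rewrite inE => /orP[/eqP ->|/h'Z yZ];
    exact: (subsetP ZA).
- by rewrite size_cat sh sh'.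
have z1 : \sum_(y <- h) deg e y h' = 0.
  rewrite big_seq big1 // => y yh; apply: deg_lnk (lZ y yh) => //.
have z2 : \sum_(y <- h) count (e x y) h' = 0.
  rewrite big_seq big1 // => y yh; apply/eqP; rewrite -leqn0 leqNgt -has_count.
  apply/hasPn => z zh; rewrite sy.1 (lZ y yh x z xZ (h'Z z zh)) //.
  by apply: contraNneq xh' => ->.
have z3 : \sum_(y <- h') deg e y h = k' * d.
  rewrite (eq_big_seq (fun=> d)) => [|y /h'Z /ZQ[[_ ->] //]].
  by rewrite big_const_seq count_predT iter_addn_0 sh' mulnC.
rewrite cnt3_cat // deg_cat z1 z2 z3 ch ch' dh dh'; split; lia.
Qed.

Lemma unav_indep w k : 0 < w -> exists j, unav w j k 0 0.
Proof.
move=> w0; elim: k => [|k [j hj]]; first by exists 0; apply: unav0.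
have [j'] := unav_comp w0 hj (@unav1 w); rewrite addn1 muln0 !addn0.
by exists j'.
Qed.

(** An edge [a b x] whose vertices [a] and [b] are replaced in turn by
    independent sets: [x] then lies in [y * z] edges. *)
Lemma unav_edge w y z : 0 < w -> exists j, unav w j (y + z) 0 (y * z).
Proof.
move=> w0; have [ja ha] := unav_indep y w0; have [jb hb] := unav_indep z w0.
pose j1 := 1 * 3 + w ^ 2 * ja.+1 + 2.
exists (j1 * y.+2 + w ^ y.+1 * jb.+1 + y.+1) => T e W s sy sp s1 A AW cA.
have sub (B : {set T}) : B \subset W -> s ^ j1 <= #|B| -> exists b h, 
    [/\ uniq (b :: h), {subset b :: h <= B}, size h = y.+1 &
      match h with [::] => False | x :: l => [/\ cnt3 e l = 0, deg e x l = 0,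
        deg e b l = 0 & forall a, a \in l -> e a b x] end].
  move=> BW cB.
  have [|h [Z [[sh uh hB] [ZB cZ ZQ lZ]]]] := @many_completions T e W s w 2 1 ja.+1
    (fun a h => match h with [:: b; x] => e a b x | _ => False end) B sp w0 s1 isT _ BW cB.
    move=> C CW; rewrite expn1 => cC; have [a [b [x [u su ex]]]] := sp.2 C CW cC.
    by exists a, [:: b; x].
  have [|u [l [ul lZ' sl [cl _]]]] := ha T e W s sy sp s1 Z (subset_trans ZB BW).
    by apply: leq_trans cZ; rewrite leq_pexp2l // ltnW.
  have {lZ' u ul} [ul lZ'] : uniq l /\ {subset l <= Z}.
    by case/andP: ul; split => // v vl; apply: lZ'; rewrite inE vl orbT.
  case: h sh uh hB ZQ lZ => [|b [|x [|]]] // _ uh hB ZQ lZ.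
  exists b, (x :: l); split.
  - move: uh; rewrite /= !inE => /andP[bx _].
    rewrite negb_or -andbA; rewrite bx ul andbT /=.
    apply/andP; split; apply/negP => /lZ' /ZQ[_]; by rewrite !inE eqxx ?orbT.
  - move=> v; rewrite !inE => /or3P[/eqP->|/eqP->|vl].
    + by apply: hB; rewrite !inE eqxx.
    + by apply: hB; rewrite !inE eqxx orbT.
    + by apply: (subsetP ZB); apply: lZ'.
  - by rewrite /= sl.
  split => //.
  - by apply: deg_lnk lZ' (lZ x _) => //; rewrite !inE eqxx orbT.
  - by apply: deg_lnk lZ' (lZ b _) => //; rewrite !inE eqxx.
  - by move=> a /lZ' /ZQ[].
have [h [Z [[sh uh hA] [ZA cZ ZQ lZ]]]] := @many_completions T e W s w y.+1 j1 jb.+1 _ A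
  sp w0 s1 isT sub AW cA.
have [|u [l2 [ul lZ' sl [cl _]]]] := hb T e W s sy sp s1 Z (subset_trans ZA AW).
  by apply: leq_trans cZ; rewrite leq_pexp2l // ltnW.
have uZ : u \in Z by apply: lZ'; rewrite mem_head.
have {lZ' ul} [ul lZ'] : uniq l2 /\ {subset l2 <= Z}.
  by case/andP: ul; split => // v vl; apply: lZ'; rewrite inE vl orbT.
case: h sh uh hA ZQ lZ => [|x l] // [sh] uh hA ZQ lZ.
have [c0 d0] : cnt3 e l = 0 /\ deg e x l = 0 by case: (ZQ u uZ) => -[].
have xl2 : x \notin l2 by apply/negP => /lZ' /ZQ[_]; rewrite inE eqxx.
move: (uh) => /= /andP[xl ull].
exists x, (l ++ l2); split.
- rewrite /= mem_cat negb_or xl xl2 cat_uniq ull ul !andbT /=.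
  by apply/hasPn => v /lZ' /ZQ[_]; rewrite inE negb_or => /andP[].
- move=> v; rewrite inE mem_cat => /or3P[vx|vl|/lZ' vZ].
  + by apply: hA; rewrite inE vx.
  + by apply: hA; rewrite inE vl orbT.
  + exact: (subsetP ZA).
- by rewrite size_cat sh sl.
have z1 : \sum_(a <- l) deg e a l2 = 0.
  rewrite big_seq big1 // => a al; apply: deg_lnk ul lZ' (lZ a _).
  by rewrite inE al orbT.
have z2 : \sum_(b <- l2) deg e b l = 0.
  by rewrite big_seq big1 // => b /lZ' /ZQ[[]].
have z3 : \sum_(a <- l) count (e x a) l2 = y * z.
  rewrite (eq_big_seq (fun=> z)) => [|a al].
    by rewrite big_const_seq count_predT iter_addn_0 sh mulnC.
  rewrite -sl; apply/eqP; rewrite -all_count; apply/allP => b /lZ' /ZQ[[_ _ _ H] _].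
  by rewrite sy.1 sy.2; apply: H.
rewrite cnt3_cat // deg_cat z1 z2 z3 d0 c0 cl; split => //.
rewrite (deg_lnk ul lZ') //; apply: lZ; exact: mem_head.
Qed.

(** Configurations of degrees 1, [p] and [p ^ 2] are substituted into one another,
    and each is followed by a block spanning no edges. The number of edges formed
    by a vertex with two earlier ones is the sum of the degrees of the preceding
    configurations, so that the lengths [a], [b], [c] of the blocks have the weights 1,
    [1 + p] and [1 + p + p ^ 2]. *)
Lemma unav_digits w p m a b c : 0 < w -> 50 * p <= m -> a < p -> b < p -> c < p ->
  exists j d, unav w j m (p.+1 + 2 * p * p.+1 +
    (a + b * p.+1 + c * (1 + p + p * p))) d.
Proof.
move=> w0 pm ap bp cp.
(* The first block, which contributes no edge, brings the size up to [m]. *)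
pose g := m - (3 + 3 * p + a + b + c).
have comp k f d k' d' : (exists j, unav w j k f d) -> (exists j, unav w j k' 0 d') ->
    exists j, unav w j (k + k') (f + k' * d) (d + d').
  by move=> [j hj] [j' hj']; have := unav_comp w0 hj hj'; rewrite addn0.
have := comp _ _ _ _ _ (comp _ _ _ _ _ (comp _ _ _ _ _ (comp _ _ _ _ _
  (comp _ _ _ _ _ (comp _ _ _ _ _ (unav_indep g w0) (unav_edge 1 1 w0))
  (unav_indep a w0)) (unav_edge 1 p w0)) (unav_indep b w0)) (unav_edge p p w0))
  (unav_indep c w0).
case=> j; set k := (X in unav w _ X); set f := (X in unav w _ _ X).
have -> : k = m by rewrite /k /g; nia.
have -> : f = p.+1 + 2 * p * p.+1 + (a + b * p.+1 + c * (1 + p + p * p)).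
  by rewrite /f; nia.
by move=> h; exists j; eexists; exact: h.
Qed.

Lemma mixed_radix_inj p a b c a' b' c' :
  a < p -> b < p -> c < p -> a' < p -> b' < p -> c' < p ->
  a + b * p.+1 + c * (1 + p + p * p) = a' + b' * p.+1 + c' * (1 + p + p * p) ->
  [/\ a = a', b = b' & c = c'].
Proof.
move=> ap bp cp ap' bp' cp' E.
have lt x y : x < p -> y < p -> x + y * p.+1 < 1 + p + p * p by nia.
have q0 : 0 < 1 + p + p * p by [].
have Ec : c = c'.
  have := congr1 (divn^~ (1 + p + p * p)) E; rewrite /= !divnDMl //.
  by rewrite !divn_small ?lt // !add0n.
move: E; rewrite Ec => /addIn E.
have Eb : b = b'.
  have := congr1 (divn^~ p.+1) E; rewrite /= !divnDMl //.
  by rewrite !divn_small ?ltnS // ltnW.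
by move: E; rewrite Eb => /addIn ->.
Qed.

(** The exponent is the maximum over the [p ^ 3] configurations. *)
Lemma sparse_links_rich w p m : 0 < w -> 50 * p <= m ->
  exists J, forall (T : finType) (e : T -> T -> T -> bool) (W : {set T}) s,
    sym3 e -> 1 < s -> sparse_links e W s w -> s ^ J <= #|W| -> rich e m (p ^ 3).
Proof.
move=> w0 pm; pose D := ('I_p * 'I_p * 'I_p)%type.
pose F (x : D) := p.+1 + 2 * p * p.+1 +
  ((x.1.1 : nat) + x.1.2 * p.+1 + x.2 * (1 + p + p * p)).
have /choice[jf hj] : forall x : D, exists j, exists d, unav w j m (F x) d.
  by move=> x; apply: unav_digits.
exists (\max_(x : D) jf x) => T e W s sy s1 sp cW; exists D, F; split.
- move=> [[a b] c] [[a' b'] c'] /addnI /= E.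
  have [] := mixed_radix_inj (ltn_ord a) (ltn_ord b) (ltn_ord c) (ltn_ord a')
    (ltn_ord b') (ltn_ord c') E.
  by move=> /val_inj -> /val_inj -> /val_inj ->.
- by rewrite !card_prod !card_ord !expnS expn0 muln1 mulnA.
- move=> x; have [d hd] := hj x.
  have [|y [h [uh _ sh [ch _]]]] := hd T e W s sy sp s1 W (subxx W).
    by apply: leq_trans cW; rewrite leq_pexp2l ?leq_bigmax // ltnW.
  by exists h; split => //; case/andP: uh.
Qed.

(** * Both kinds of homogeneous links *)

Lemma Dw_first t w : Dw (fun x _ => x) t w = lsum (nseq (size w) t).
Proof. by elim: w => [|a w IH] //=; rewrite IH size_nseq. Qed.

(** If the link of the first vertex is homogeneous on a set containing all later
    ones, then it is the label of this vertex that gives the colour. *)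
Lemma words_of_links (T : finType) (e : T -> T -> T -> bool) (S : nat -> nat) m :
  (forall i (U : {set T}) b, i < m -> S i.+1 <= #|U| ->
     exists v (A : {set T}), [/\ v \in U, A \subset U :\ v, S i <= #|A| & lnk e b v A]) ->
  forall i w (U : {set T}), size w = i -> i <= m -> S i <= #|U| ->
  exists l, [/\ uniq l, {subset l <= U}, size l = i & cnt3 e l = Fw (fun x _ => x) w].
Proof.
move=> hS; elim=> [|i IH] [|t w] U //= sw im cU; first by exists [::]; split.
have [v [A [vU AU cA lA]]] := hS i U t im cU.
have [l [ul lA' sl cl]] := IH w A (eq_add_S _ _ sw) (ltnW im) cA.
have lU y : y \in l -> (y != v) && (y \in U).
  by move/lA'/(subsetP AU); rewrite !inE.
exists (v :: l); split => /=.
- by rewrite ul andbT; apply/negP => /lU; rewrite eqxx.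
- by move=> y; rewrite inE => /orP[/eqP ->|/lU /andP[]].
- by rewrite sl.
- by rewrite (deg_lnkE ul lA' lA) cl Dw_first sl; case: sw => ->.
Qed.

(** * Ramsey's theorem for pairs *)

(** The classical first half of the proof of Ramsey's theorem: the first element
    keeps the later elements of its majority colour. *)
Lemma end_homogeneous (C : finType) n : exists N, forall (f : nat -> nat -> C) s,
  sorted ltn s -> N <= size s ->
  exists l h, [/\ sorted ltn l, {subset l <= s}, size l = n &
    forall i j, i \in l -> j \in l -> i < j -> f i j = h i].
Proof.
elim: n => [|n [N IH]].
  exists 1 => f [|x s] // _ _; exists [::], (f x); split => //.
exists (#|C| * N).+1 => f [|x s] //= xs; rewrite ltnS => cs.
have C0 : 0 < #|C| by apply/card_gt0P; exists (f x x).
have [c hc] := pigeonhole_seq (f x) s C0.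
set s' := [seq y <- s | f x y == c] in hc.
have ss : sorted ltn s' by rewrite /s' (sorted_filter ltn_trans) // (path_sorted xs).
have [|l [h [sl ls zl hl]]] := IH f s' ss.
  by rewrite -(leq_pmul2l C0) (leq_trans cs).
have xl y : y \in l -> [/\ x < y, y \in s & f x y = c].
  move/ls; rewrite mem_filter => /andP[/eqP -> ys]; split => //.
  by have /allP := order_path_min ltn_trans xs; apply.
exists (x :: l), (fun i => if i == x then c else h i); split => /=.
- by rewrite path_min_sorted //; apply/allP => y /xl[].
- by move=> y; rewrite !inE => /orP[->//|/xl[_ ->]]; rewrite orbT.
- by rewrite zl.
- move=> i j; rewrite !inE => /orP[/eqP ->|il] /orP[/eqP ->|jl].
  + by rewrite ltnn.
  + by rewrite eqxx; case: (xl j jl).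
  + by case: (xl i il) => xi _ _ ix; lia.
  + case: eqP => [ix _|_]; last exact: hl.
    by case: (xl i il); rewrite ix ltnn.
Qed.

Lemma ramsey_pairs (C : finType) n : exists N, forall f : nat -> nat -> C,
  exists l c, [/\ sorted ltn l, all (gtn N) l, size l = n &
    forall i j, i \in l -> j \in l -> i < j -> f i j = c].
Proof.
have [N HN] := end_homogeneous C (#|C| * n); exists N => f.
have C0 : 0 < #|C| by apply/card_gt0P; exists (f 0 0).
have [|l [h [sl ls zl hl]]] := HN f (iota 0 N) (iota_ltn_sorted 0 N).
  by rewrite size_iota.
have [c] := pigeonhole_seq h l C0; rewrite zl leq_pmul2l // => hc.
set l' := [seq y <- l | h y == c] in hc.
have sub y : y \in take n l' -> y \in l /\ h y = c.
  by move/mem_take; rewrite mem_filter => /andP[/eqP].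
exists (take n l'), c; split.
- by rewrite take_sorted // /l' (sorted_filter ltn_trans).
- by apply/allP => y /sub[/ls]; rewrite mem_iota.
- by rewrite size_take_min; apply/minn_idPl.
- by move=> i j /sub[il <-] /sub[jl _]; apply: hl.
Qed.

(** * Erdős–Rado sequences *)

(** These are the sequences of the proof by Erdős and Rado of Ramsey's theorem for
    triples. They turn a colouring of the triples into a colouring [c] of the
    pairs, to which the theorem for pairs applies. *)
Definition er (T : eqType) (e : T -> T -> T -> bool) (w : nat -> T) (n : nat)
    (c : nat -> nat -> bool) : Prop :=
  (forall i j, i < n -> j < n -> w i = w j -> i = j) /\
  (forall i j k, i < j -> j < k -> k < n -> e (w i) (w j) (w k) = c i j).

Fixpoint C3 (c : nat -> nat -> bool) (l : seq nat) : nat :=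
  if l is i :: l' then lsum (map (c i) l') + C3 c l' else 0.

Lemma deg_map (T : Type) (e : T -> T -> T -> bool) (w : nat -> T) n v
    (b : nat -> bool) l :
  (forall j k, j \in l -> j < k -> k < n -> e v (w j) (w k) = b j) ->
  sorted ltn l -> all (gtn n) l -> deg e v (map w l) = lsum (map b l).
Proof.
elim: l => [|j l IH] //= H jl /andP[jn ln].
rewrite IH ?(path_sorted jl) //; last by move=> i k il; apply: H; rewrite inE il orbT.
rewrite size_map; congr (_ + _).
have /allP jl' : all (ltn j) l by exact: order_path_min ltn_trans jl.
rewrite count_map (eq_in_count (a2 := fun=> b j)) => [|k kl].
  by case: (b j); rewrite /= ?mul1n ?mul0n ?count_predT ?count_pred0.
by apply: H; [exact: mem_head | exact: jl' | exact: (allP ln)].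
Qed.

Lemma cnt3_er (T : eqType) (e : T -> T -> T -> bool) w n c l :
  er e w n c -> sorted ltn l -> all (gtn n) l -> cnt3 e (map w l) = C3 c l.
Proof.
move=> [_ ec]; elim: l => [|i l IH] //= il /andP[_ ln].
rewrite IH ?(path_sorted il) // (@deg_map _ e w n _ (c i)) ?(path_sorted il) //.
have /allP il' : all (ltn i) l by exact: order_path_min ltn_trans il.
by move=> j k jl; apply: ec; apply: il'.
Qed.

Lemma er_uniq (T : eqType) (e : T -> T -> T -> bool) w n c l :
  er e w n c -> sorted ltn l -> all (gtn n) l -> uniq (map w l).
Proof.
move=> [wi _] sl ln; rewrite map_inj_in_uniq ?(sorted_uniq ltn_trans ltnn) //.
by move=> i j il jl; apply: wi; apply: (allP ln).
Qed.

(** The vertices at the two places [o + 2 * i] and [o + 2 * i + 1] carry the labels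
    0 and 1, so that any word can be read off by one choice for each [i] in [I]. *)
Definition sel (o : nat) (I : seq nat) (wd : seq bool) : seq nat :=
  [seq o + x.1.*2 + (x.2 : bool) | x <- zip I wd].

Lemma size_sel o I wd : size I = size wd -> size (sel o I wd) = size wd.
Proof. by move=> h; rewrite size_map size_zip h minnn. Qed.

Lemma mem_sel o I wd k : k \in sel o I wd ->
  exists i (t : bool), i \in I /\ k = o + i.*2 + t.
Proof.
move=> /mapP[[i t] it ->]; exists i, t; split => //.
elim: I wd it => [|a I IH] [|b wd] //=; rewrite !inE => /orP[/eqP[-> _]|/IH ->];
  by rewrite ?eqxx ?orbT.
Qed.

Lemma sel_sorted o I wd : sorted ltn I -> sorted ltn (sel o I wd).
Proof.
elim: I wd => [|i I IH] [|t wd] //= iI; rewrite path_min_sorted ?IH ?(path_sorted iI) //.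
apply/allP => k /mem_sel[j [u [jI ->]]].
have /allP/(_ _ jI) /= ij : all (ltn i) I by exact: order_path_min ltn_trans iI.
by case: t; case: u => /=; lia.
Qed.

Lemma map_sel (C : Type) (b : nat -> C) (G : bool -> C) o I wd : size I = size wd ->
  (forall i (t : bool), i \in I -> b (o + i.*2 + t) = G t) ->
  map b (sel o I wd) = map G wd.
Proof.
elim: I wd => [|i I IH] [|t wd] //= [sI] H; rewrite H ?mem_head //.
by rewrite IH // => j u jI; apply: H; rewrite inE jI orbT.
Qed.

Lemma Dw_lsum g t wd : Dw g t wd = lsum (map (g t) wd).
Proof. by elim: wd => [|a wd IH] //=; rewrite IH size_map. Qed.

(** Here the number of edges of an Erdős–Rado sequence becomes that of a word. *)
Lemma C3_sel c g o I wd : sorted ltn I -> size I = size wd ->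
  (forall i j (t u : bool), i \in I -> j \in I -> i < j ->
     c (o + i.*2 + t) (o + j.*2 + u) = g t u) ->
  C3 c (sel o I wd) = Fw g wd.
Proof.
elim: I wd => [|i I IH] [|t wd] //= iI [sI] H.
have /allP il : all (ltn i) I by exact: order_path_min ltn_trans iI.
rewrite -/(sel o I wd) IH ?(path_sorted iI) //; last first.
  by move=> a b u v aI bI; apply: H; rewrite inE ?aI ?bI orbT.
rewrite Dw_lsum (@map_sel _ _ (g t)) // => j u jI.
by apply: H; rewrite ?mem_head ?inE ?jI ?orbT //; apply: il.
Qed.

Lemma er_words (T : eqType) (e : T -> T -> T -> bool) w n c g o I wd :
  er e w n c -> sorted ltn I -> size I = size wd ->
  (forall i, i \in I -> o + i.*2 + 1 < n) ->
  (forall i j (t u : bool), i \in I -> j \in I -> i < j ->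
     c (o + i.*2 + t) (o + j.*2 + u) = g t u) ->
  attained e (size wd) (Fw g wd).
Proof.
move=> E sI zI In H; exists (map w (sel o I wd)).
have al : all (gtn n) (sel o I wd).
  apply/allP => k /mem_sel[i [t [iI ->]]]; have := In i iI => /=.
  by case: t => /=; lia.
split; [exact: er_uniq E (sel_sorted _ _ sI) al|by rewrite size_map size_sel|].
by rewrite (cnt3_er E) ?sel_sorted // (C3_sel sI zI H).
Qed.

(** The colour of a vertex is carried by the pairs of which it is the first
    element; the last vertex found is therefore discarded. *)
Lemma ramsey_vertices_pairs (C1 C2 : finType) n : exists N,
  forall (f1 : nat -> C1) (f2 : nat -> nat -> C2),
  exists l c1 c2, [/\ sorted ltn l, all (gtn N) l, size l = n,
    forall i, i \in l -> f1 i = c1 &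
    forall i j, i \in l -> j \in l -> i < j -> f2 i j = c2].
Proof.
have [N HN] := ramsey_pairs (C1 * C2)%type n.+1; exists N => f1 f2.
have [l [[c1 c2] [sl al zl H]]] := HN (fun i j => (f1 i, f2 i j)).
case/lastP: l sl al zl H => [|l x] // sl al; rewrite size_rcons => -[zl] H.
have lx i : i \in l -> i < x.
  move=> il; move: sl; rewrite (sorted_pairwise ltn_trans) pairwise_rcons.
  by case/andP=> /allP/(_ _ il).
have ml i : i \in l -> i \in rcons l x by rewrite mem_rcons inE => ->; rewrite orbT.
exists l, c1, c2; split => //.
- by move: sl; rewrite -cats1 => /cat_sorted2[].
- by move: al; rewrite all_rcons => /andP[].
- move=> i il; have mx : x \in rcons l x by rewrite mem_rcons mem_head.
  by case: (H i x (ml i il) mx (lx i il)).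
- by move=> i j il jl ij; case: (H i j (ml i il) (ml j jl) ij).
Qed.

Lemma sumn_map_bool (G : bool -> nat) wd :
  sumn (map G wd) = G false * count negb wd + G true * count id wd.
Proof.
elim: wd => [|[] wd IH] /=; rewrite ?muln0 // IH !mulnDr muln1 muln0 add0n.
  by rewrite addnCA.
by rewrite addnA.
Qed.

Lemma count_negb wd : count negb wd = size wd - count id wd.
Proof. by rewrite -(count_predC id wd) addKn; apply: eq_count. Qed.

Lemma Fw_const a wd :
  Fw (fun _ _ => a) wd = Fw (fun _ _ => a) (nseq (size wd) false).
Proof.
have D t u v : size u = size v -> Dw (fun _ _ => a) t u = Dw (fun _ _ => a) t v.
  by elim: u v => [|b u IH] [|d v] //= [s]; rewrite s (IH v).
elim: wd => [|t wd IH] //=; rewrite -IH; congr (_ + _).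
rewrite !Dw_lsum; congr lsum.
by elim: (wd) => [|b u IHu] //=; rewrite IHu.
Qed.

Lemma lsum_map_bool (phi : bool -> bool) wd :
  ((lsum (map phi wd))%:Z = (phi false)%:Z * (lsum (nseq (size wd) true))%:Z +
    ((phi true)%:Z - (phi false)%:Z) * (lsum wd)%:Z)%R.
Proof.
elim: wd => [|t wd IH] /=; first by rewrite !mulr0.
by rewrite !PoszD IH size_map size_nseq !PoszM; case: t => /=; ring.
Qed.

(** If the pairs of the first part are monochromatic, the order of its labels only
    matters for the pairs formed with the second part. *)
Lemma C3_sel_cat c a o I wd l2 : sorted ltn I -> size I = size wd ->
  (forall i j (t u : bool), i \in I -> j \in I -> i < j ->
     c (o + i.*2 + t) (o + j.*2 + u) = a) ->
  C3 c (sel o I wd ++ l2) = Fw (fun _ _ => a) wd + a * 'C(size wd, 2) * size l2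
   + sumn (map (fun i => lsum (map (c i) l2)) (sel o I wd)) + C3 c l2.
Proof.
elim: I wd => [|i I IH] [|t wd] //=; first by rewrite muln0.
move=> iI [sI] H; have /allP il : all (ltn i) I by exact: order_path_min ltn_trans iI.
rewrite -/(sel o I wd) IH ?(path_sorted iI) //; last first.
  by move=> u v x y uI vI; apply: H; rewrite inE ?uI ?vI orbT.
have E : map (c (o + i.*2 + t)) (sel o I wd) = map (fun=> a) wd.
  apply: map_sel => // j u jI.
  by apply: H; rewrite ?mem_head ?inE ?jI ?orbT //; apply: il.
rewrite map_cat lsum_cat E size_map Dw_lsum count_map.
rewrite (eq_count (a2 := fun=> a)) //.
have -> : count (fun=> a) wd = a * size wd.
  by case: (a); rewrite ?mul1n ?mul0n ?count_predT ?count_pred0.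
by rewrite binS bin1; nia.
Qed.

Definition one_word (N z : nat) : seq bool :=
  nseq (N.-1 - z) false ++ true :: nseq z false.

Lemma one_wordP N z : z < N ->
  [/\ size (one_word N z) = N, count id (one_word N z) = 1 &
      lsum (one_word N z) = z].
Proof.
move=> zN; rewrite /one_word; split.
- by rewrite size_cat /= !size_nseq; lia.
- by rewrite count_cat /= !count_nseq.
- by rewrite lsum_cat /= !lsum_false count_nseq size_nseq; lia.
Qed.

(** Modulo [p] the value determines [z], whatever the integer [kap] is; then it
    determines [t]. *)
Lemma progression_inj (p : nat) (K kap : int) (F : nat -> nat -> nat) :
  (forall t z, t < p * p -> z < p ->
    ((F t z)%:Z = K + p%:Z * t%:Z + z%:Z + p%:Z * kap * z%:Z)%R) ->
  forall t z t' z', t < p * p -> z < p -> t' < p * p -> z' < p ->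
  F t z = F t' z' -> t = t' /\ z = z'.
Proof.
move=> H t z t' z' tp zp tp' zp' /(congr1 Posz); rewrite !H // => E.
have [q hq] : exists q : int, (z%:Z - z'%:Z = p%:Z * q)%R.
  exists (t'%:Z - t%:Z + kap * (z'%:Z - z%:Z))%R.
  have -> : (p%:Z * (t'%:Z - t%:Z + kap * (z'%:Z - z%:Z)) =
      p%:Z * t'%:Z - p%:Z * t%:Z + (p%:Z * kap * z'%:Z - p%:Z * kap * z%:Z))%R by ring.
  by move: E; move: (p%:Z * kap * _)%R (p%:Z * kap * _)%R => u v; lia.
have q0 : q = 0%R by nia.
have ez : z = z' by move: hq; rewrite q0 mulr0; lia.
split => //; move: E; rewrite ez => E.
have : (p%:Z * t%:Z = p%:Z * t'%:Z)%R by lia.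
by nia.
Qed.

Lemma deg_bin (T : Type) (e : T -> T -> T -> bool) x l : deg e x l < ('C(size l, 2)).+1.
Proof. by rewrite ltnS -(deg_flip e x l) leq_addl. Qed.

(** The situation reached after the applications of Ramsey's theorem. The clones
    [S] of the first wild vertex precede an Erdős–Rado sequence whose places below
    [o] carry the labels seen by [S], whose place [o] is the second wild vertex,
    and whose places above [o] carry the labels seen by the latter. All other
    colours only depend on labels. Both words are read with fixed numbers of
    letters, [p] letters of each kind in the first word and a single 1 in the
    second one. An inversion of the first word is seen by the [p] clones. Moving
    the 1 of the second word is seen once by the second wild vertex; it is also
    seen in the same way by all the clones, and by the [p] vertices of each label
    in the first part, hence altogether 1 plus [kap] times [p] edges arise. *)
Lemma uniform_rich (T : eqType) (e : T -> T -> T -> bool) (p m o : nat)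
    (w : nat -> T) (n : nat) (c : nat -> nat -> bool) (S : seq T) (cs : nat -> bool)
    (I1 I2 : seq nat) (a1 a2 : bool) (b1 b2 : bool -> nat) (gam phi : bool -> bool)
    (q : bool -> bool -> bool) :
  sym3 e -> 50 * p <= m -> er e w n c ->
  uniq S -> size S = p -> (forall k, k < n -> w k \notin S) ->
  (forall s j k, s \in S -> j < k -> k < n -> e s (w j) (w k) = cs j) ->
  sorted ltn I1 -> size I1 = 2 * p -> (forall i, i \in I1 -> i.*2 + 1 < o) ->
  sorted ltn I2 -> size I2 = m - 3 * p - 1 ->
  (forall i, i \in I2 -> o.+1 + i.*2 + 1 < n) -> o < n ->
  (forall i (t : bool), i \in I1 -> cs (0 + i.*2 + t) = t) ->
  (forall i (t : bool), i \in I2 -> c o (o.+1 + i.*2 + t) = t) ->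
  (forall i j (t u : bool), i \in I1 -> j \in I1 -> i < j ->
     c (0 + i.*2 + t) (0 + j.*2 + u) = a1) ->
  (forall i j (t u : bool), i \in I2 -> j \in I2 -> i < j ->
     c (o.+1 + i.*2 + t) (o.+1 + j.*2 + u) = a2) ->
  (forall i (t : bool), i \in I1 -> deg e (w (0 + i.*2 + t)) S = b1 t) ->
  (forall i (t : bool), i \in I2 -> deg e (w (o.+1 + i.*2 + t)) S = b2 t) ->
  (forall i (t : bool), i \in I1 -> c (0 + i.*2 + t) o = gam t) ->
  (forall i (t : bool), i \in I2 -> cs (o.+1 + i.*2 + t) = phi t) ->
  (forall i j (t u : bool), i \in I1 -> j \in I2 ->
     c (0 + i.*2 + t) (o.+1 + j.*2 + u) = q t u) ->
  rich e m (p ^ 3).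
Proof.
move=> sy pm E uS sS wS Scs sI1 zI1 I1o sI2 zI2 I2n on cs1 co2 c11 c22 d1 d2 cg cp cq.
pose N := m - 3 * p - 1.
have zltN z : z < p -> z < N by rewrite /N; lia.
have sizes : p + (2 * p + N.+1) = m \/ p = 0 by rewrite /N; lia.
have pp : 2 * p - p = p by lia.
have N1 : N - 1 = N.-1 by lia.
pose l1 t := sel 0 I1 (inv_word p t); pose l2 z := sel o.+1 I2 (one_word N z).
pose L t z := l1 t ++ o :: l2 z.
have L1o t k : k \in l1 t -> k < o.
  by move=> /mem_sel[i [u [iI ->]]]; have := I1o i iI; case: u => /=; lia.
have L2n z k : k \in l2 z -> o < k < n.
  by move=> /mem_sel[i [u [iI ->]]]; have := I2n i iI; case: u => /=; lia.
have sL t z : sorted ltn (L t z).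
  rewrite /L (sorted_pairwise ltn_trans) pairwise_cat /= -!(sorted_pairwise ltn_trans).
  rewrite !sel_sorted // andbT /=; apply/andP; split.
    apply/allrelP => i j /L1o io; rewrite inE => /orP[/eqP-> //|/L2n]; lia.
  by apply/allP => j /L2n; lia.
have aL t z : all (gtn n) (L t z).
  apply/allP => k; rewrite mem_cat inE => /or3P[/L1o|/eqP->|/L2n] /=; lia.
pose F t z := cnt3 e (S ++ map w (L t z)).
pose kap := ((phi true)%:Z - (phi false)%:Z + ((q false true)%:Z - (q false false)%:Z)
  + ((q true true)%:Z - (q true false)%:Z))%R.
pose A := lsum (nseq N true).
(* The number of edges at [t = 0] and [z = 0]. *)
pose K : int := (cnt3 e S + (Fw (fun _ _ => a1) (nseq (2 * p) false)
    + a1 * 'C(2 * p, 2) * N.+1 + p * (gam false * N + q false false * A)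
    + p * (gam true * N + q true false * A) + Fw (fun _ _ => a2) (nseq N false))
    + p * (lsum (nseq p true) + p * N.+1 + cs o * N + phi false * A)
    + (b1 false * p + b1 true * p + deg e (w o) S + b2 false * N.-1 + b2 true))%N.
have FE t z : t < p * p -> z < p ->
    ((F t z)%:Z = K + p%:Z * t%:Z + z%:Z + p%:Z * kap * z%:Z)%R.
  move=> tp zp; have [s1 n1 h1] := inv_wordP tp.
  have zN := zltN z zp.
  have [s2 n2 h2] := one_wordP zN.
  have z1 : size I1 = size (inv_word p t) by rewrite s1.
  have z2 : size I2 = size (one_word N z) by rewrite s2.
  have zl2 : size (l2 z) = N by rewrite size_sel.
  rewrite /F cnt3_cat // big_map.
  have -> : \sum_(x <- S) deg e x (map w (L t z)) = p * lsum (map cs (L t z)).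
    rewrite (eq_big_seq (fun=> lsum (map cs (L t z)))) => [|s sIS].
      by rewrite big_const_seq count_predT iter_addn_0 sS mulnC.
    by apply: (@deg_map _ e w n) => // j k _; apply: Scs.
  have -> : \sum_(j <- L t z) deg e (w j) S
     = b1 false * p + b1 true * p + (deg e (w o) S + (b2 false * N.-1 + b2 true)).
    have bs l : \sum_(j <- l) deg e (w j) S = sumn (map (fun j => deg e (w j) S) l).
      by rewrite sumnE big_map.
    rewrite big_cat big_cons /= !bs (map_sel z1 d1) (map_sel z2 d2) !sumn_map_bool.
    by rewrite !count_negb s1 s2 n1 n2 pp N1 muln1.
  rewrite (cnt3_er E (sL t z) (aL t z)).
  rewrite (C3_sel_cat _ sI1 z1 c11) /= -/(l2 z).
  rewrite (C3_sel sI2 z2 c22) Fw_const s1 [Fw (fun _ _ => a2) _]Fw_const s2 zl2.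
  have -> : map (c o) (l2 z) = map id (one_word N z) by apply: map_sel.
  rewrite map_id h2.
  rewrite (@map_sel _ _ (fun u => gam u * N + lsum (map (q u) (one_word N z)))) //;
    last first.
    move=> i u iI; rewrite cg // size_map zl2; congr (_ + lsum _).
    by apply: map_sel => // j v jI; apply: cq.
  rewrite sumn_map_bool count_negb n1 s1.
  have -> : lsum (map cs (L t z)) =
      lsum (nseq p true) + t + p * N.+1 + (cs o * N + lsum (map phi (one_word N z))).
    rewrite /L map_cat lsum_cat /= size_map zl2 (map_sel (G := id) z1) //.
    by rewrite (map_sel z2 cp) map_id h1 n1.
  have lq b := lsum_map_bool b (one_word N z).
  have l1' := lq (q false); have l2' := lq (q true); have l3' := lq phi.
  rewrite s2 h2 -/A in l1' l2' l3'.
  rewrite /K /kap !PoszD !PoszM !PoszD !PoszM l1' l2' l3'.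
  rewrite pp ?PoszM ?PoszD.
  ring.
move: K kap FE => K kap FE; have inj := progression_inj FE.
exists ('I_(p * p) * 'I_p)%type, (fun d : 'I_(p * p) * 'I_p => F d.1 d.2); split.
- move=> [t z] [t' z'] /= /inj[] // ? ?.
  by congr pair; apply: val_inj.
- by rewrite card_prod !card_ord !expnS expn0 muln1 mulnA.
move=> [t z] /=; exists (S ++ map w (L t z)); split => //.
  rewrite cat_uniq uS (er_uniq E (sL t z) (aL t z)) andbT /=.
  by apply/hasPn => x /mapP[k kL ->]; apply: wS; apply: (allP (aL t z)).
have [s1 _ _] := inv_wordP (ltn_ord t).
have zp := ltn_ord z.
have [s2 _ _] := one_wordP (zltN z zp).
rewrite size_cat sS size_map size_cat /= !size_sel ?s1 ?s2 //.
by lia.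
Qed.

Lemma nonconstPn g : ~ nonconst g -> forall t u, g t u = g false false.
Proof. by move=> h t u; apply: contrapT => ne; apply: h; exists t, u, false, false. Qed.

Lemma er_words_rich (T : eqType) (e : T -> T -> T -> bool) w n c g o I p m :
  nonconst g -> 50 * p <= m -> er e w n c -> sorted ltn I -> size I = m ->
  (forall i, i \in I -> o + i.*2 + 1 < n) ->
  (forall i j (t u : bool), i \in I -> j \in I -> i < j ->
     c (o + i.*2 + t) (o + j.*2 + u) = g t u) ->
  rich e m (p ^ 3).
Proof.
move=> ng pm E sI zI In H; apply: words_rich ng pm _ => wd swd.
by rewrite -swd; apply: er_words E sI _ In H; rewrite zI swd.
Qed.

(** Ramsey's theorem is applied first to the second part of the sequence, whose
    vertices are coloured by their pairs with all vertices of the first part, and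
    then to the first part; this makes the colours between the two parts depend on
    labels only. If the colour of a pair inside one of the parts depends on the
    labels, that part alone realises all words. *)
Lemma cloned_er_rich p m : 50 * p <= m -> exists L1 L2,
  forall (T : eqType) (e : T -> T -> T -> bool) (w : nat -> T)
    (c : nat -> nat -> bool) (S : seq T) (cs : nat -> bool),
  let n := L1.*2.+1 + L2.*2 in
  sym3 e -> er e w n c ->
  uniq S -> size S = p -> (forall k, k < n -> w k \notin S) ->
  (forall s j k, s \in S -> j < k -> k < n -> e s (w j) (w k) = cs j) ->
  (forall i (t : bool), i < L1 -> cs (i.*2 + t) = t) ->
  (forall i (t : bool), i < L2 -> c L1.*2 (L1.*2.+1 + i.*2 + t) = t) ->
  rich e m (p ^ 3).
Proof.
move=> pm; pose B := 'C(p, 2); pose C2 := {ffun bool * bool -> bool}.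
pose CV := {ffun bool -> 'I_B.+1 * bool}.
have [L1 H1] := ramsey_vertices_pairs (CV * C2)%type C2 m.
have [L2 H2] := ramsey_vertices_pairs (CV * {ffun 'I_L1 * bool * bool -> bool})%type C2 m.
exists L1, L2 => T e w c S cs n sy E uS sS wS Scs cs1 co2.
pose o := L1.*2.
have pB x : deg e x S < B.+1 by rewrite /B -sS; apply: deg_bin.
have [J2 [[v2 q2] [g2 [sJ2 aJ2 zJ2 V2 P2]]]] := H2
  (fun j => ([ffun u : bool => (inord (deg e (w (o.+1 + j.*2 + u)) S),
                               cs (o.+1 + j.*2 + u))],
             [ffun x : 'I_L1 * bool * bool =>
               c (0 + (x.1.1 : nat).*2 + x.1.2) (o.+1 + j.*2 + x.2)]))
  (fun i j => [ffun x : bool * bool => c (o.+1 + i.*2 + x.1) (o.+1 + j.*2 + x.2)]).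
pose qq i t u := if insub i is Some i' then q2 (i', t, u) else false.
have [J1 [[v1 q1] [g1 [sJ1 aJ1 zJ1 V1 P1]]]] := H1
  (fun i => ([ffun u : bool => (inord (deg e (w (0 + i.*2 + u)) S),
                               c (0 + i.*2 + u) o)],
             [ffun x : bool * bool => qq i x.1 x.2]))
  (fun i j => [ffun x : bool * bool => c (0 + i.*2 + x.1) (0 + j.*2 + x.2)]).
have J1L i : i \in J1 -> i < L1 by move=> iJ; apply: (allP aJ1).
have J2L i : i \in J2 -> i < L2 by move=> iJ; apply: (allP aJ2).
have P1' i j (t u : bool) : i \in J1 -> j \in J1 -> i < j ->
    c (0 + i.*2 + t) (0 + j.*2 + u) = g1 (t, u).
  by move=> iJ jJ ij; rewrite -(P1 i j iJ jJ ij) ffunE.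
have P2' i j (t u : bool) : i \in J2 -> j \in J2 -> i < j ->
    c (o.+1 + i.*2 + t) (o.+1 + j.*2 + u) = g2 (t, u).
  by move=> iJ jJ ij; rewrite -(P2 i j iJ jJ ij) ffunE.
have J1n i : i \in J1 -> 0 + i.*2 + 1 < n by move=> /J1L; rewrite /n; lia.
have J2n i : i \in J2 -> o.+1 + i.*2 + 1 < n by move=> /J2L; rewrite /n /o; lia.
have [ng|/nonconstPn k1] := pselect (nonconst (fun t u => g1 (t, u))).
  by apply: (er_words_rich (o := 0) (I := J1) ng pm E).
have [ng|/nonconstPn k2] := pselect (nonconst (fun t u => g2 (t, u))).
  by apply: (er_words_rich (o := o.+1) (I := J2) ng pm E).
pose I1 := take (2 * p) J1; pose I2 := take (m - 3 * p - 1) J2.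
have I1J i : i \in I1 -> i \in J1 by apply: mem_take.
have I2J i : i \in I2 -> i \in J2 by apply: mem_take.
have V1' i (t : bool) : i \in I1 ->
    deg e (w (0 + i.*2 + t)) S = (v1 t).1 /\ c (0 + i.*2 + t) o = (v1 t).2.
  by move=> /I1J/V1[<- _]; rewrite ffunE /= inordK.
have V2' i (t : bool) : i \in I2 ->
    deg e (w (o.+1 + i.*2 + t)) S = (v2 t).1 /\ cs (o.+1 + i.*2 + t) = (v2 t).2.
  by move=> /I2J/V2[<- _]; rewrite ffunE /= inordK.
apply: (@uniform_rich T e p m o w n c S cs I1 I2 (g1 (false, false)) (g2 (false, false))
  (fun t => (v1 t).1) (fun t => (v2 t).1) (fun t => (v1 t).2) (fun t => (v2 t).2)
  (fun t u => q1 (t, u))) => //.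
- by rewrite /I1 take_sorted.
- by rewrite /I1 size_take_min zJ1; lia.
- by move=> i /I1J/J1L; rewrite /o; lia.
- by rewrite /I2 take_sorted.
- by rewrite /I2 size_take_min zJ2; lia.
- by move=> i /I2J/J2n.
- by rewrite /n /o; lia.
- by move=> i t /I1J/J1L iL; rewrite add0n; exact: cs1 iL.
- by move=> i t /I2J/J2L iL; exact: co2 iL.
- by move=> i j t u /I1J iJ /I1J jJ ij; rewrite P1' // k1.
- by move=> i j t u /I2J iJ /I2J jJ ij; rewrite P2' // k2.
- by move=> i t iI; case: (V1' i t iI).
- by move=> i t iI; case: (V2' i t iI).
- by move=> i t iI; case: (V1' i t iI).
- by move=> i t iI; case: (V2' i t iI).
move=> i j t u /I1J iJ /I2J jJ.
have [_ <-] := V1 i iJ; have [_ Q2] := V2 j jJ.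
rewrite ffunE /= /qq; case: insubP => [i' _ ii|]; last by rewrite J1L.
by rewrite -Q2 ffunE /= ii.
Qed.

(** * Growing Erdős–Rado sequences *)

(** [Y] is the reservoir from which the sequence can be continued. *)
Definition er_tail (T : finType) (e : T -> T -> T -> bool) (w : nat -> T) (n : nat)
    (c : nat -> nat -> bool) (Y : {set T}) : Prop :=
  [/\ er e w n c, forall i, i < n -> w i \notin Y &
      forall i j y, i < j -> j < n -> y \in Y -> e (w i) (w j) y = c i j].

Definition upd (T : Type) (w : nat -> T) (n : nat) (u : T) : nat -> T :=
  fun i => if i == n then u else w i.

(** The reservoir is split according to the colours of the pairs formed by [u] and
    an earlier vertex, and the majority class is kept. *)
Lemma er_extend (T : finType) (e : T -> T -> T -> bool) w n c (Y Y1 : {set T}) u :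
  er_tail e w n c Y -> u \in Y -> Y1 \subset Y :\ u ->
  exists c' (Y' : {set T}), [/\ Y' \subset Y1, #|Y1| <= 2 ^ n * #|Y'|,
    er_tail e (upd w n u) n.+1 c' Y',
    forall i j, j < n -> c' i j = c i j &
    forall i b, i < n -> 0 < #|Y'| -> (forall y, y \in Y1 -> e (w i) u y = b) ->
      c' i n = b].
Proof.
move=> [[wi wc] wY cY] uY YY1.
have /subsetP sY := subset_trans YY1 (subsetDl Y [set u]).
have uY1 : u \notin Y1.
  by apply/negP => /(subsetP YY1); rewrite !inE eqxx.
pose f y := [ffun i : 'I_n => e (w i) u y].
have [|g] := @pigeonhole T {ffun 'I_n -> bool} Y1 f.
  by rewrite card_ffun card_bool expn_gt0.
rewrite card_ffun card_bool card_ord; set Y' := [set y in Y1 | f y == g] => cY1.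
have Y'P y : y \in Y' -> y \in Y1 /\ forall i (h : i < n), e (w i) u y = g (Ordinal h).
  by rewrite inE => /andP[yY /eqP <-]; split => // i h; rewrite ffunE.
pose b i := if insub i is Some i' then g i' else false.
have bE i (h : i < n) : b i = g (Ordinal h) by rewrite /b insubT.
exists (fun i j => if j == n then b i else c i j), Y'; split => //.
- by apply/subsetP => y /Y'P[].
- split.
  + split.
      move=> i j; rewrite !ltnS /upd => ir jr.
      case: eqP ir => [-> _|/eqP ni ir]; case: eqP jr => [-> _|/eqP nj jr] //.
      * by move=> uw; move: (wY j); rewrite -uw uY; lia.
      * by move=> uw; move: (wY i); rewrite uw uY; lia.
      * by apply: wi; lia.
    move=> i j k ij jk kn; rewrite /upd.
    have -> : (i == n) = false by lia.
    have -> : (j == n) = false by lia.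
    case: eqP => [_|/eqP nk]; first by apply: cY => //; lia.
    by apply: wc => //; lia.
  + move=> i ir; rewrite /upd; case: eqP => [_|/eqP ni].
      by apply/negP => /Y'P[] /(negP uY1).
    by apply/negP => /Y'P[/sY yY _]; move: (wY i); rewrite yY; lia.
  + move=> i j y ij jn /Y'P[yY1 yg]; rewrite /upd.
    have -> : (i == n) = false by lia.
    case: eqP => [_|/eqP nj].
      have h : i < n by lia.
      by rewrite (bE _ h) -(yg i h).
    by apply: cY (sY _ yY1) => //; lia.
- by move=> i j jn; case: eqP => // jn'; lia.
- move=> i b0 h /card_gt0P[y /Y'P[yY1 yg]] H; rewrite eqxx (bE _ h) -yg.
  exact: H.
Qed.

(** The neighbourhoods of the vertices of a maximal independent set, which has
    less than [r] elements, cover the graph. *)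
Lemma link_degree (T : finType) (e : T -> T -> T -> bool) t v (Y : {set T}) r :
  sym3 e -> 0 < #|Y| ->
  (forall A : {set T}, A \subset Y -> lnk e (~~ t) v A -> #|A| < r) ->
  exists2 u, u \in Y & #|Y| <= r * #|[set y in Y :\ u | e v u y == t]|.+1.
Proof.
move=> sy Y0 hA.
pose P (A : {set T}) := (A \subset Y) && `[< lnk e (~~ t) v A >].
have P0 : P set0 by rewrite /P sub0set; apply/asboolP => x y; rewrite inE.
have [A /andP[AY /asboolP lA] Amax] := arg_maxnP (fun A : {set T} => #|A|) P0.
pose D u := [set y in Y :\ u | e v u y == t].
apply: contrapT => no.
have lt u : u \in A -> r * #|D u|.+1 < #|Y|.
  move=> uA; rewrite ltnNge; apply/negP => h; apply: no; exists u => //.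
  exact: (subsetP AY).
have cov : Y \subset \bigcup_(u in A) (u |: D u).
  apply/subsetP => y yY; apply/bigcupP; apply: contrapT => ny.
  have yA : y \notin A.
    by apply/negP => yA; apply: ny; exists y => //; rewrite !inE eqxx.
  have nt u : u \in A -> e v u y = ~~ t.
    move=> uA; have [eq|ne] := eqVneq (e v u y) t; last first.
      by case: (e v u y) ne; case: (t).
    case: ny; exists u => //; rewrite !inE yY eq eqxx !andbT.
    by case: eqP.
  have : P (y |: A).
    rewrite /P subUset sub1set yY AY /=; apply/asboolP => a b.
    rewrite !inE => /orP[/eqP ->|aA] /orP[/eqP ->|bA] ab.
    - by rewrite eqxx in ab.
    - by rewrite sy.2 nt.
    - exact: nt.
    - exact: lA.
  by move=> /Amax; rewrite cardsU1 yA; lia.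
have cY : #|Y| <= \sum_(u in A) #|D u|.+1.
  apply: leq_trans (subset_leq_card cov) _.
  elim/big_rec2: _ => [|u k B _ IH]; first by rewrite cards0.
  apply: leq_trans (leq_add _ IH); first exact: (leq_card_setU _ _).1.
  by rewrite cardsU1; case: (u \in _).
have Ar := hA A AY lA.
have : r * #|Y| <= #|A| * #|Y|.-1.
  apply: leq_trans (leq_mul (leqnn r) cY) _.
  rewrite big_distrr /= -sum_nat_const; apply: leq_sum => u /lt; lia.
by nia.
Qed.

(** As the link of [w i0] has no large homogeneous subset of either colour, each
    step finds a vertex [u] with the prescribed colour [tau j] towards a proportion
    at least about [1 / r] of the reservoir; passing to the majority class costs
    another bounded factor. *)
Lemma tagged_run (T : finType) (e : T -> T -> T -> bool) i0 r L (tau : nat -> bool) :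
  sym3 e -> forall n w c (Y : {set T}) M, i0 < n -> 0 < M -> er_tail e w n c Y ->
  (forall b (A : {set T}), A \subset Y -> lnk e b (w i0) A -> #|A| < r) ->
  (r * 2 ^ (n + L).+1) ^ L * M <= #|Y| ->
  exists w' c' (Y' : {set T}), [/\ Y' \subset Y, M <= #|Y'|,
    er_tail e w' (n + L) c' Y',
    (forall i, i < n -> w' i = w i) /\ (forall i, n <= i < n + L -> w' i \in Y) &
    (forall i j, j < n -> c' i j = c i j) /\
    (forall j, j < L -> c' i0 (n + j) = tau j)].
Proof.
move=> sy; elim: L tau => [|L IH] tau n w c Y M i0n M0 E hr cY.
  exists w, c, Y; rewrite addn0; split => //; first by rewrite mul1n in cY.
  by split => // i; lia.
have r0 : 0 < r by have := hr true set0 (sub0set _); rewrite cards0; apply=> x y; rewrite inE.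
pose R := r * 2 ^ (n + L.+1).+1.
have R0 : 0 < R by rewrite /R muln_gt0 r0 expn_gt0.
have Y0 : 0 < #|Y|.
  by apply: leq_trans cY; rewrite muln_gt0 M0 andbT expn_gt0 -/R R0.
have [u uY hu] := link_degree (t := tau 0) sy Y0 (hr (~~ tau 0)).
set Y1 := [set y in Y :\ u | e (w i0) u y == tau 0] in hu.
have Y1Y : Y1 \subset Y :\ u by apply/subsetP => y; rewrite inE => /andP[].
have [c1 [Y' [YY1 cY' E' old new]]] := er_extend E uY Y1Y.
have YY : Y' \subset Y by apply: subset_trans YY1 (subset_trans Y1Y (subsetDl _ _)).
have big : R ^ L.+1 * M <= r * (2 ^ n * #|Y'|).+1.
  by apply: leq_trans cY (leq_trans hu _); rewrite leq_mul2l ltnS cY' orbT.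
have pw : 2 ^ (n + L.+1).+1 = 2 ^ n * 2 ^ L.+2 by rewrite -expnD; congr (_ ^ _); lia.
have two : 1 < 2 ^ L.+2 by rewrite -{1}(expn0 2) ltn_exp2l.
have n1 : 0 < 2 ^ n by rewrite expn_gt0.
have RL : 0 < R ^ L by rewrite expn_gt0 R0.
have Rr : r * 2 * 2 ^ n <= R by rewrite /R pw; nia.
have Y'0 : 0 < #|Y'|.
  rewrite lt0n; apply/eqP => z; move: big; rewrite z muln0 muln1 expnS.
  have : R <= R * R ^ L * M by rewrite -mulnA leq_pmulr // muln_gt0 RL.
  by move=> h1 h2; move: (leq_trans h1 h2) Rr n1 r0; clearbody R; clear; nia.
have cM : (r * 2 ^ (n.+1 + L).+1) ^ L * M <= #|Y'|.
  rewrite addSnnS -/R; rewrite -(leq_pmul2l R0) mulnA -expnS.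
  apply: leq_trans big _; apply: leq_trans (leq_mul Rr (leqnn _)).
  have : 0 < 2 ^ n * #|Y'| by rewrite muln_gt0 n1.
  by rewrite -!mulnA leq_mul2l; move: (2 ^ n * _) => k k0; apply/orP; right; lia.
have w0 : upd w n u i0 = w i0 by rewrite /upd; case: eqP => // ?; lia.
have [|w' [c' [Y2 [Y2Y cY2 E2 [wo wn] [co cn]]]]] :=
  IH (fun j => tau j.+1) n.+1 (upd w n u) c1 Y' M (ltnW i0n) M0 E' _ cM.
  by move=> b A AY; rewrite w0; apply: hr; apply: subset_trans AY YY.
rewrite -addSnnS; exists w', c', Y2; split => //; first exact: subset_trans Y2Y YY.
- split=> i.
    by move=> ir; rewrite wo 1?ltnW // /upd; case: eqP => // ?; lia.
  move=> /andP[]; rewrite leq_eqVlt => /orP[/eqP <- _|ir il].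
    by rewrite wo // /upd eqxx.
  by apply: (subsetP YY); apply: wn; rewrite ir.
- split=> [i j jn|[_|j jL]].
  + by rewrite co 1?ltnW // old.
  + rewrite addn0 co //; apply: new => // y.
    by rewrite inE => /andP[_ /eqP].
  + by rewrite -addSnnS cn.
Qed.

Lemma leq_expl (m n k : nat) : m <= n -> m ^ k <= n ^ k.
Proof. by move=> mn; case: k => [|k] //; rewrite leq_exp2r. Qed.

(** The bound [r] on the independent sets of the link is measured against the size
    of [A]: each step of [tagged_run] divides the reservoir by roughly [r], so that
    [r ^ w] allows about [w] steps. *)
Definition wild_links (T : finType) (e : T -> T -> T -> bool) (W : {set T})
    (s w k a : nat) : Prop :=
  forall U : {set T}, U \subset W -> s ^ k <= #|U| ->
  exists v (A : {set T}) r, [/\ v \in U, A \subset U :\ v, s ^ a <= r, r ^ w <= #|A| &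
    forall B : {set T}, B \subset A -> lnk e false v B -> #|B| < r].

(** The second wild vertex is taken from the reservoir left by the sequence of the
    first one, so that all the vertices together form an Erdős–Rado sequence. The
    labels alternate, so that consecutive places offer both of them. *)
Lemma wild_config (T : finType) (e : T -> T -> T -> bool) (W : {set T})
    s w J L1 L2 (U : {set T}) :
  sym3 e -> 0 < J ->
  (forall v (A : {set T}), v \in W -> A \subset W :\ v -> lnk e true v A -> #|A| < s) ->
  wild_links e W s w (J * J) J -> wild_links e W s w J 1 ->
  2 ^ (L1.*2 + L2.*2 + 4) <= s -> 4 * L1.*2 + 4 * L2.*2 < w ->
  U \subset W -> s ^ (J * J) <= #|U| ->
  exists x c, let n := (L1.*2.+1 + L2.*2).+1 in
    [/\ er e x n c, forall i, i < n -> x i \in U,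
     forall i (t : bool), i < L1 -> c 0 (i.*2 + t).+1 = t &
     forall i (t : bool), i < L2 ->
       c L1.*2.+1 (L1.*2.+1 + i.*2 + t).+1 = t].
Proof.
move=> sy J0 full X1 X2 s2 wL UW cU.
have ib i (t : bool) L : i < L -> i.*2 + t < L.*2 by case: t; clear; lia.
have q1 : ((1 + L1.*2).+1 + L2.*2).+1 <= L1.*2 + L2.*2 + 4 by clear; lia.
have q2 : 1 + L1.*2 <= L1.*2 + L2.*2 + 4 by clear; lia.
have q3 : (2 * L2.*2).+1 <= w by move: wL; clear; lia.
have q4 : (2 * L1.*2).+1 <= w by move: wL; clear; lia.
have En : (1 + L1.*2).+1 + L2.*2 = (L1.*2.+1 + L2.*2).+1 by clear; lia.
have s0 : 0 < s by apply: leq_trans s2; rewrite expn_gt0.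
have sJ : s <= s ^ J by rewrite -{1}(expn1 s) leq_pexp2l.
have pw i j : i <= j -> 2 ^ i <= 2 ^ j by move=> ij; rewrite leq_pexp2l.
have [v [A [r [vU AU rJ cA hA]]]] := X1 U UW cU.
have sr : s <= r := leq_trans sJ rJ.
have r0 : 0 < r by exact: leq_trans sr.
have AW : A \subset W by apply: subset_trans AU (subset_trans (subsetDl _ _) UW).
have vA : v \notin A by apply/negP => /(subsetP AU); rewrite !inE eqxx.
have hr b (B : {set T}) : B \subset A -> lnk e b v B -> #|B| < r.
  move=> BA; case: b => lB; last exact: hA.
  apply: leq_trans sr; apply: full lB; first exact: (subsetP UW).
  by apply: subset_trans BA (subset_trans AU (setSD _ UW)).
have E0 : er_tail e (fun=> v) 1 (fun _ _ => false) A.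
  split; [split|by []|] => [i j|i j k|i j y] //; rewrite ?ltnS; clear; lia.
have sJ0 : 0 < s ^ J by rewrite expn_gt0 s0.
have r2 k : 2 ^ k <= r -> (r * 2 ^ k) ^ L1.*2 * s ^ J <= r ^ w.
  move=> kr; apply: (@leq_trans (r ^ (2 * L1.*2).+1)); last by rewrite leq_pexp2l.
  rewrite expnSr; apply: leq_mul => //; rewrite expnM; apply: leq_expl.
  by rewrite -mulnn leq_mul2l kr orbT.
have c1 : (r * 2 ^ (1 + L1.*2).+1) ^ L1.*2 * s ^ J <= #|A|.
  apply: leq_trans cA; apply: r2; apply: leq_trans sr; apply: leq_trans s2.
  by apply: pw; lia.
have [w1 [k1 [Y1 [Y1A cY1 E1 [w1o w1n] [_ t1]]]]] :=
  tagged_run odd sy (ltn0Sn 0) sJ0 E0 hr c1.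
have Y1W := subset_trans Y1A AW.
have [v' [A' [r' [vY1 AY1 rJ' cA' hA']]]] := X2 Y1 Y1W cY1.
rewrite expn1 in rJ'.
have [k2 [Y2 [YA2 cY2 E2 k2o _]]] := er_extend E1 vY1 AY1.
have r'0 : 0 < r' by exact: leq_trans rJ'.
set N1 := (1 + L1.*2) in E1 E2 k2o.
have wN1 : upd w1 N1 v' N1 = v' by rewrite /upd eqxx.
have hr' b (B : {set T}) : B \subset Y2 -> lnk e b (upd w1 N1 v' N1) B -> #|B| < r'.
  rewrite wN1 => BY2; have BA' := subset_trans BY2 YA2.
  case: b => lB; last exact: hA'.
  apply: leq_trans rJ'; apply: full lB; first exact: (subsetP Y1W).
  by apply: subset_trans BA' (subset_trans AY1 (setSD _ Y1W)).
have c2 : (r' * 2 ^ (N1.+1 + L2.*2).+1) ^ L2.*2 * 1 <= #|Y2|.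
  have kr : 2 ^ (N1.+1 + L2.*2).+1 <= r'.
    by apply: leq_trans rJ'; apply: leq_trans s2; apply: pw.
  have kr' : 2 ^ N1 <= r'.
    by apply: leq_trans rJ'; apply: leq_trans s2; apply: pw.
  have p0 : 0 < 2 ^ N1 by rewrite expn_gt0.
  rewrite muln1 -(leq_pmul2l p0); apply: leq_trans cY2; apply: leq_trans cA'.
  apply: (@leq_trans (r' ^ (2 * L2.*2).+1)); last by rewrite leq_pexp2l.
  rewrite [X in _ <= X]expnS; apply: leq_mul => //; rewrite expnM; apply: leq_expl.
  by rewrite -mulnn leq_mul2l kr orbT.
have [w3 [k3 [Y3 [Y3Y2 _ E3 [w3o w3n] [k3o t3]]]]] :=
  tagged_run odd sy (ltnSn N1) (ltn0Sn 0) E2 hr' c2.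
rewrite En in E3; case: E3 => E3 _ _.
have oddE i (t : bool) : odd (i.*2 + t) = t by rewrite oddD odd_double; case: t.
exists w3, k3; split => //.
- move=> i ir; case: (ltnP i N1.+1) => iN; last first.
    have : w3 i \in Y2 by apply: w3n; rewrite iN En.
    move/(subsetP YA2)/(subsetP AY1); rewrite inE => /andP[_ /(subsetP Y1A)].
    by move/(subsetP AU); rewrite inE => /andP[].
  rewrite w3o // /upd; case: eqP => [_|/eqP iN1].
    by have := subsetP AU _ (subsetP Y1A _ vY1); rewrite inE => /andP[].
  case: (posnP i) => [->|i0]; first by rewrite w1o.
  have : w1 i \in A by apply: w1n; rewrite i0 ltn_neqAle iN1.
  by move/(subsetP AU); rewrite inE => /andP[].
- move=> i t iL'; have {iL'} iL := ib _ t _ iL'; have iN : (i.*2 + t).+1 < N1 by rewrite /N1 add1n ltnS.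
  by rewrite k3o ?k2o // 1?ltnW // -add1n t1 ?oddE.
- move=> i t iL'; have {iL'} iL := ib _ t _ iL'; have -> : (L1.*2.+1 + i.*2 + t).+1 = N1.+1 + (i.*2 + t).
    by rewrite /N1 -addnA.
  by rewrite -[L1.*2.+1]/N1 t3 ?oddE.
Qed.

(** The configuration of [wild_config] is present in all large sets, so its first
    vertex has many clones; those of one majority class see the sequence in the
    same way. *)
Lemma wild_rich p m : 50 * p <= m -> exists w s0 k,
  0 < w /\ forall J (T : finType) (e : T -> T -> T -> bool) (W : {set T}) s,
  sym3 e -> 0 < J -> s0 <= s ->
  (forall v (A : {set T}), v \in W -> A \subset W :\ v -> lnk e true v A -> #|A| < s) ->
  wild_links e W s w (J * J) J -> wild_links e W s w J 1 ->
  s ^ (J * J * k).+1 <= #|W| -> rich e m (p ^ 3).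
Proof.
move=> pm; have [L1 [L2 H]] := cloned_er_rich pm.
pose n := L1.*2.+1 + L2.*2; pose z := p.+1 * 2 ^ n.
exists (4 * L1.*2 + 4 * L2.*2).+1, (2 ^ (L1.*2 + L2.*2 + 4) + (z + n)), n.+1.
split=> // J T e W s sy J0 s0 full X1 X2 cW.
have z0 : 0 < z by rewrite muln_gt0 expn_gt0.
have spos : 0 < s by apply: leq_trans s0; rewrite addn_gt0 expn_gt0.
pose Q v h := exists x c, [/\ er e x n.+1 c, x 0 = v, h = map x (iota 1 n),
  forall i (t : bool), i < L1 -> c 0 (i.*2 + t).+1 = t &
  forall i (t : bool), i < L2 -> c L1.*2.+1 (L1.*2.+1 + i.*2 + t).+1 = t].
have [|||h [Z [[sh uh hW] [ZW cZ ZQ]]]] :=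
    @supersaturation T W (s ^ (J * J)) n z Q _ z0.
- move=> A AW cA.
  have [||x [c [E xA t1 t2]]] := wild_config (L1 := L1) (L2 := L2) sy J0 full X1 X2 _ (ltnSn _) AW.
  + by apply: leq_trans s0; apply: leq_addr.
  + by rewrite cA.
  have em : x 0 :: map x (iota 1 n) = map x (iota 0 n.+1) by [].
  exists (x 0), (map x (iota 1 n)); rewrite em; split.
  + apply: (er_uniq E); first exact: iota_ltn_sorted.
    by apply/allP => i; rewrite mem_iota.
  + by move=> y /mapP[i]; rewrite mem_iota => /andP[_ ir] ->; apply: xA.
  + by rewrite size_map size_iota.
  + by exists x, c.
- apply: leq_trans cW; rewrite leq_pexp2l //; nia.
- apply: leq_trans cW; rewrite [X in _ <= X]expnSr -expnM.
  apply: (@leq_trans (s ^ (J * J * n.+1) * (z + n))); last first.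
    by rewrite leq_mul2l; apply/orP; right; apply: leq_trans s0; apply: leq_addl.
  by rewrite mulnDr leq_add2l leq_pmull // expn_gt0 spos.
have [v0 v0Z] : exists v, v \in Z by apply/card_gt0P; apply: leq_trans cZ.
pose wh := nth v0 h.
have whE x : h = map x (iota 1 n) -> forall k, k < n -> wh k = x k.+1.
  by move=> hE k kn; rewrite /wh hE (nth_map 0) ?size_iota // nth_iota // add1n.
pose f v := [ffun j : 'I_n => e v (wh j) (wh j.+1)].
have [|phi] := @pigeonhole T {ffun 'I_n -> bool} Z f.
  by rewrite card_ffun card_bool expn_gt0.
rewrite card_ffun card_bool card_ord; set Zc := [set v in Z | f v == phi] => cZc.
have pZ : p < #|Zc|.
  have : 2 ^ n * p.+1 <= 2 ^ n * #|Zc| by rewrite mulnC; apply: leq_trans cZc.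
  by rewrite leq_pmul2l ?expn_gt0.
pose cs j := if insub j is Some j' then phi j' else false.
have csE v j k : v \in Zc -> j < k -> k < n -> e v (wh j) (wh k) = cs j.
  rewrite inE => /andP[vZ /eqP fv] jk kn.
  have jn : j < n by lia.
  have [[x [c [[_ xc] x0 hx _ _]]] _] := ZQ v vZ.
  rewrite /cs insubT -fv ffunE /= !(whE x hx) //; last by lia.
  by rewrite -x0 !xc //; lia.
have [v1 v1Zc] : exists v, v \in Zc by apply/card_gt0P; apply: leq_trans pZ.
have v1Z : v1 \in Z by move: v1Zc; rewrite inE => /andP[].
have [[x1 [c1 [[xi xc] x10 hx1 t1 t2]]] _] := ZQ v1 v1Z.
have SZ s1 : s1 \in take p (enum Zc) -> s1 \in Zc.
  by move/mem_take; rewrite mem_enum.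
apply: (H T e wh (fun i j => c1 i.+1 j.+1) (take p (enum Zc)) cs) => //.
- split=> [i j|i j k ij jk] ir; last first.
    by rewrite !(whE _ hx1) //; [rewrite xc|lia|lia].
  by move=> jr; rewrite !(whE _ hx1) // => /xi; rewrite !ltnS => /(_ ir jr) [].
- by rewrite take_uniq // enum_uniq.
- by rewrite size_take_min -cardE; apply/minn_idPl; apply: ltnW.
- move=> k kn; apply/negP => /SZ; rewrite inE => /andP[/ZQ[_ /negP + _]]; apply.
  by rewrite mem_nth // sh.
- by move=> s1 j k /SZ; apply: csE.
- move=> i t iL.
  have j1 : (i.*2 + t).+1 < n by rewrite /n; case: t; lia.
  rewrite -(csE v1 _ _ v1Zc (ltnSn _) j1) !(whE _ hx1) //; last by lia.
  by rewrite -x10 xc // t1.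
Qed.

(** If no link contains a large complete set, then the links are either wild
    everywhere, or sparse inside some large set. *)
Lemma no_complete_links_rich p m : 50 * p <= m -> exists K s0, 0 < K /\
  forall (T : finType) (e : T -> T -> T -> bool) (W : {set T}) s,
  sym3 e -> s0 <= s ->
  (forall v (A : {set T}), v \in W -> A \subset W :\ v -> lnk e true v A -> #|A| < s) ->
  (forall A : {set T}, A \subset W -> s <= #|A| ->
     exists x y z, [/\ uniq [:: x; y; z], {subset [:: x; y; z] <= A} & e x y z]) ->
  s ^ K <= #|W| -> rich e m (p ^ 3).
Proof.
move=> pm; have [w [s0 [k [w0 H]]]] := wild_rich pm.
have [J0 HJ] := sparse_links_rich w0 pm; pose J := J0.+1.
exists (J * J * k).+1, (s0 + 2); split => // T e W s sy ss full hedge cW.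
have s1 : 1 < s by lia.
have sp a : 0 < a -> ~ wild_links e W s w (J * a) a -> rich e m (p ^ 3).
  move=> a0 /existsNP[U] /not_implyP[UW] /not_implyP[cU no].
  have sa : s <= s ^ a by rewrite -{1}(expn1 s) leq_pexp2l // ltnW.
  apply: (HJ T e U (s ^ a) sy).
  - exact: leq_trans sa.
  - split=> [v A r vU AU vA sr cA|A AU cA].
      apply: contrapT => no'; apply: no; exists v, A, r; split => //.
        by rewrite subsetD1 AU.
      move=> B BA lB; rewrite ltnNge; apply/negP => rB; apply: no'.
      by exists B.
    by apply: hedge; [apply: subset_trans UW|apply: leq_trans cA].
  - by apply: leq_trans cU; rewrite -expnM leq_pexp2l 1?ltnW // /J; nia.
have [X1|/sp] := pselect (wild_links e W s w (J * J) J); last exact.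
have [X2|] := pselect (wild_links e W s w J 1); last first.
  by rewrite -{1}(muln1 J) => /sp; apply.
by apply: (H J T e W s) => //; lia.
Qed.

Definition hom3 (T : finType) (e : T -> T -> T -> bool) (b : bool) (A : {set T}) : Prop :=
  forall x y z, uniq [:: x; y; z] -> {subset [:: x; y; z] <= A} -> e x y z = b.

(** The sizes [s ^ (K ^ i)] are the levels of the first case of the proof: each
    vertex chosen costs one level. If a level is the place where this fails, then
    [s ^ (K ^ i)] serves as the base for the other two cases. *)
Lemma no_hom_rich p m : 50 * p <= m -> exists E s0,
  forall (T : finType) (e : T -> T -> T -> bool) s,
  sym3 e -> s0 <= s -> s ^ E <= #|T| ->
  (forall b (A : {set T}), hom3 e b A -> #|A| < s) -> rich e m (p ^ 3).
Proof.
move=> pm; have [K [s0 [K0 H]]] := no_complete_links_rich pm.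
exists (K ^ m), (s0 + 1) => T e s sy ss cT nohom.
pose S i := s ^ (K ^ i).
have sS i : s <= S i by rewrite -{1}(expn1 s) /S leq_pexp2l ?expn_gt0 ?K0 //; lia.
have [links|] := pselect (forall i (U : {set T}) b, i < m -> S i.+1 <= #|U| ->
     exists v (A : {set T}), [/\ v \in U, A \subset U :\ v, S i <= #|A| & lnk e b v A]).
  apply: (@words_rich T e (fun x _ => x)) pm _ => [|wd swd].
    by exists true, true, false, true.
  have [|l [ul _ sl cl]] := words_of_links links (U := setT) swd (leqnn m).
    by rewrite cardsT.
  by exists l.
move=> /existsNP[i] /existsNP[U] /existsNP[b] /not_implyP[im] /not_implyP[cU no].
have full v (A : {set T}) : v \in U -> A \subset U :\ v -> lnk e b v A -> #|A| < S i.
  by move=> vU AU lA; rewrite ltnNge; apply/negP => cA; apply: no; exists v, A.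
have cU' : S i ^ K <= #|U| by rewrite /S -expnM -expnSr.
have edge c (A : {set T}) : A \subset U -> S i <= #|A| ->
    exists x y z, [/\ uniq [:: x; y; z], {subset [:: x; y; z] <= A} & e x y z = c].
  move=> AU cA; apply: contrapT => ne.
  have : #|A| < s.
    apply: (nohom (~~ c)) => x y z u sub; apply: contrapT => ec; apply: ne.
    by exists x, y, z; split => //; case: (c) (e x y z) ec => [] [].
  by have := sS i; lia.
have si : s0 <= S i by have := sS i; lia.
case: b no full => no full; first by apply: (H T e U (S i)) => //; apply: edge.
apply: rich_flip; apply: (H T (flip e) U (S i)) => //.
- exact: sym3_flip.
- move=> v A vU AU lA; apply: (full v A vU AU) => x y xA yA xy.
  by apply: negbTE; apply: lA.
- move=> A AU cA; have [x [y [z [u sub ez]]]] := edge false A AU cA.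
  by exists x, y, z; rewrite /flip ez.
Qed.

(** * Back to 3-graphs *)

Definition tri (V : finType) (G : three_graph V) (x y z : V) : bool :=
  [set x; y; z] \in edges G.

Lemma sym3_tri (V : finType) (G : three_graph V) : sym3 (tri G).
Proof. by split=> x y z; rewrite /tri; [rewrite (setUC [set x])|rewrite setUAC]. Qed.

Lemma card_induced_edges (V : finType) (G : three_graph V) (l : seq V) :
  uniq l -> #|induced_edges G [set x in l]| = cnt3 (tri G) l.
Proof.
move=> ul; rewrite (cnt3_nsub (mem (edges G)) ul); apply: eq_card => P.
rewrite !inE; case: (boolP (P \in edges G)) => [PE|_]; last by rewrite !andbF.
by rewrite (edges_card3 PE) eqxx !andbT.
Qed.

Lemma leq_num_induced_sizes (V : finType) (G : three_graph V) m q :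
  rich (tri G) m q -> q <= num_induced_sizes G m.
Proof.
case=> D [F [iF qD vF]]; apply: leq_trans qD _.
have Fm d : F d < 'C(m, 3).+1.
  by have [l [_ <- <-]] := vF d; rewrite ltnS -(cnt3_flip (tri G) l) leq_addl.
pose f d : 'I_('C(m, 3)).+1 := Ordinal (Fm d).
have injf : injective f by move=> d d' [] /iF.
rewrite -(card_codom injf); apply: subset_leq_card; apply/subsetP => _ /codomP[d ->]; rewrite inE.
have [l [ul sl cl]] := vF d; apply/existsP; exists [set x in l].
by rewrite /mf_subset card_induced_edges //= cl eqxx andbT cardsE (card_uniqP ul) sl.
Qed.

Lemma num_induced_sizes_gt0 (V : finType) (G : three_graph V) m :
  m <= #|V| -> 0 < num_induced_sizes G m.
Proof.
move=> mV; apply: leq_num_induced_sizes.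
exists unit, (fun _ => cnt3 (tri G) (take m (enum V))); rewrite card_unit.
split => [[] [] //|//|_]; exists (take m (enum V)); split => //.
  by rewrite take_uniq // enum_uniq.
by rewrite size_take_min -cardE; apply/minn_idPl.
Qed.

Lemma hom3_homogeneous (V : finType) (G : three_graph V) b (A : {set V}) :
  hom3 (tri G) b A -> homogeneous G A.
Proof.
have tr (T : {set V}) : #|T| = 3 -> exists x y z, uniq [:: x; y; z] /\ T = [set x; y; z].
  move=> T3; have := enum_uniq T; have := set_enum T; move: T3; rewrite cardE.
  case: (enum T) => [|x [|y [|z []]]] // _ <- u; exists x, y, z; split => //.
  by apply/setP => v; rewrite !inE orbA.
move=> h; have H (T : {set V}) : T \subset A -> #|T| = 3 -> (T \in edges G) = b.
  move=> TA /tr[x [y [z [u eT]]]]; rewrite eT; apply: h u _ => v.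
  by move=> vT; apply: (subsetP TA); rewrite eT; move: vT; rewrite !inE orbA.
by case: b H {h} => H; [left|right] => T TA T3; rewrite H.
Qed.

Lemma integer_root (E n t : nat) : 0 < E -> t ^ E <= n ->
  exists s, [/\ t <= s, s ^ E <= n & n < s.+1 ^ E].
Proof.
move=> E0 tn; have ex : exists s, s ^ E <= n by exists t.
have ub s : s ^ E <= n -> s <= n.
  by apply: leq_trans; rewrite -{1}(expn1 s); case: s => // s; rewrite leq_pexp2l.
case: (ex_maxnP ex ub) => s sn smax; exists s; split => //; first exact: smax.
by rewrite ltnNge; apply/negP => /smax; rewrite ltnn.
Qed.

Local Open Scope ring_scope.

Theorem theorem1p4 (R : realType) :
  exists2 c : R, 0 < c &
    forall m : nat, (3 <= m)%N ->
      exists2 eps : R, 0 < eps &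
        exists n0 : nat, forall n : nat, (n0 <= n)%N ->
          forall (V : finType) (G : three_graph V), #|V| = n ->
            (~ exists S : {set V},
                 homogeneous G S /\ n%:R `^ eps <= (#|S|)%:R :> R) ->
            c * m%:R ^+ 3 <= (num_induced_sizes G m)%:R.
Proof.
(* For [50 <= m] the count is at least [(m %/ 50) ^ 3], and [m <= 100 * (m %/ 50)];
   for smaller [m] one edge count is enough. *)
exists (100%:R ^+ 3)^-1 => [|m m3]; first by rewrite invr_gt0 exprn_gt0 ?ltr0n.
have [E [s0 HE]] := @no_hom_rich (m %/ 50) m (leq_trans (eq_leq (mulnC _ _)) (leq_divM m 50)).
pose E' := E.+1; exists (2 * E'%:R)^-1; first by rewrite invr_gt0 mulr_gt0 ?ltr0n.
pose t := (s0 + m + 2)%N; exists (t ^ E')%N => n tn V G cV nohom.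
have [//|s [ts sn ns]] := @integer_root E' n t _ tn.
have nm : (m <= #|V|)%N.
  rewrite cV; apply: leq_trans sn; apply: (@leq_trans s).
    by move: ts; rewrite /t; lia.
  by rewrite -{1}(expn1 s) leq_pexp2l //; move: ts; rewrite /t; lia.
(* As [n < s.+1 ^ E' <= s ^ (2 * E')], the exponent [1 / (2 * E')] gives at most [s]. *)
have ns' : n%:R `^ (2 * E'%:R)^-1 <= s%:R :> R.
  have -> : s%:R = (s%:R `^ (2 * E'%:R)) `^ (2 * E'%:R)^-1 :> R.
    by rewrite -powRrM divff ?powRr1 // lt0r_neq0 // mulr_gt0 ?ltr0n.
  rewrite ge0_ler_powR ?nnegrE ?powR_ge0 ?invr_ge0 ?mulr_ge0 //.
  have -> : 2 * E'%:R = (2 * E')%N%:R :> R by rewrite natrM.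
  rewrite powR_mulrn // -natrX ler_nat expnM ltnW // (leq_trans ns) //.
  apply: leq_expl; rewrite -mulnn; move: ts; rewrite /t; clear; nia.
have rich_m : rich (tri G) m ((m %/ 50) ^ 3).
  apply: (HE V (tri G) s (sym3_tri G)).
  - by move: ts; rewrite /t; lia.
  - rewrite cV; apply: leq_trans sn; rewrite leq_pexp2l //.
    by move: ts; rewrite /t; lia.
  - move=> b A hA; rewrite ltnNge; apply/negP => sA; apply: nohom; exists A.
    split; first exact: hom3_homogeneous hA.
    by apply: le_trans ns' _; rewrite ler_nat.
have := leq_num_induced_sizes rich_m; have := num_induced_sizes_gt0 G nm.
move: (num_induced_sizes G m) => N N0 pN.
rewrite mulrC ler_pdivrMr ?exprn_gt0 ?ltr0n // -!natrX -natrM ler_nat.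
have [m50|m50] := ltnP m 50.
  apply: leq_trans (leq_pmull _ N0); apply: leq_expl; lia.
apply: leq_trans (leq_mul pN (leqnn _)); rewrite -expnMn; apply: leq_expl.
by have := divn_eq m 50; have := ltn_pmod m (ltn0Sn 49); have := divn_gt0 m (ltn0Sn 49); lia.
Qed.
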